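(* Let $G$ be a group. Let $R$ be a ring whose idempotents are all trivial. Suppose that the map induced by the inclusion $R\to RG$ $$K_0(R)\otimes_{\mathbb{Z}}\mathbb{Q}\to K_0(RG)\otimes_{\mathbb{Z}}\mathbb{Q}$$ is an isomorphism. Then all idempotents of $RG$ are trivial (i.e. the Kaplansky Conjecture holds for $R$ and $G$) if one of the following conditions is satisfied: (i) $RG$ is stably finite; (ii) $R$ is a field of characteristic zero; (iii) $R$ is a skew-field and $G$ is sofic.
   Context: Rings are associative with unit, not necessarily commutative; fields are commutative. An idempotent is trivial if it equals $0$ or $1$. A ring $S$ is directly finite if $rs=1$ implies $sr=1$ for all $r,s\in S$; it is stably finite if the matrix ring $M_n(S)$ is directly finite for all $n\ge1$. A group $G$ is sofic if for every finite subset $E\subseteq G$ and every $\varepsilon>0$ there are an integer $n\ge1$ and a map $\sigma\colon G\to\mathrm{Sym}(n)$ such that, with $d(\pi,\pi')=\frac1n|\{i\mid\pi(i)\ne\pi'(i)\}|$ the normalized Hamming distance, $d(\sigma(gh),\sigma(g)\sigma(h))\le\varepsilon$ for all $g,h\in E$, $\sigma(1)=\mathrm{id}$, and $d(\sigma(g),\sigma(h))\ge1-\varepsilon$ for all distinct $g,h\in E$. *)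

(* Defs.v *)
From HB Require Import structures.
From mathcomp Require Import all_boot all_order perm all_algebra.
From mathcomp Require Import finmap boolp monalg.

Set Implicit Arguments.
Unset Strict Implicit.
Unset Printing Implicit Defensive.

Import GRing.Theory.

Local Open Scope ring_scope.
Local Open Scope quotient_scope.

(* Rings are [pzRingType]s: associative, unital, possibly zero. *)

Definition trivial_idempotents (S : pzRingType) : Prop :=
  forall e : S, e * e = e -> e = 0 \/ e = 1.

Definition directly_finite (S : pzRingType) : Prop :=
  forall r s : S, r * s = 1 -> s * r = 1.

Definition stably_finite (S : pzRingType) : Prop :=
  forall n : nat, (1 <= n)%N -> directly_finite 'M[S]_n.

Definition is_skew_field (R : pzRingType) : Prop :=
  (1 : R) != 0 /\ forall x : R, x != 0 -> exists y : R, x * y = 1 /\ y * x = 1.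

Definition is_field (R : pzRingType) : Prop :=
  is_skew_field R /\ forall x y : R, x * y = y * x.

Definition char_zero (R : pzRingType) : Prop :=
  forall n : nat, (0 < n)%N -> n%:R != 0 :> R.

(* The normalized Hamming distance takes rational values, so letting the
   positive [eps] range over [rat] is the same as letting it range over the
   reals. Products in ['S_n] compose left to right; as [hamming] is invariant
   under inverses, [sofic] does not depend on this choice. *)

Definition hamming n (s t : 'S_n) : rat :=
  #|[pred i | s i != t i]|%:R / n%:R.

Definition sofic (G : groupType) : Prop :=
  forall (E : seq G) (eps : rat), 0 < eps ->
  exists n : nat, (1 <= n)%N /\ exists sigma : G -> 'S_n,
    [/\ forall g h, g \in E -> h \in E ->
          hamming (sigma (g * h)%g) (sigma g * sigma h)%g <= eps,
        sigma 1%g = 1%g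
      & forall g h, g \in E -> h \in E -> g != h ->
          1 - eps <= hamming (sigma g) (sigma h)].

Section FreeExtension.
Variables (K : choiceType) (V A : zmodType) (F : K -> V -> A).
Hypothesis FD : forall k a b, F k (a + b) = F k a + F k b.

Let F0 k : F k 0 = 0.
Proof. by apply: (addrI (F k 0)); rewrite -FD !addr0. Qed.

Lemma malg_sumw (x : {malg V[K]}) (d : {fset K}) : (msupp x `<=` d)%fset ->
  \sum_(k <- msupp x) F k x@_k = \sum_(k <- d) F k x@_k.
Proof.
by move=> sd; apply: big_fset_incl sd _ => k _ /mcoeff_outdom ->; rewrite F0.
Qed.

Lemma malg_sumD (x y : {malg V[K]}) :
  \sum_(k <- msupp (x + y)) F k (x + y)@_k =
  \sum_(k <- msupp x) F k x@_k + \sum_(k <- msupp y) F k y@_k.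
Proof.
rewrite (malg_sumw (msuppD_le x y)) (malg_sumw (fsubsetUl (msupp x) (msupp y))).
rewrite (malg_sumw (fsubsetUr (msupp x) (msupp y))) -big_split /=.
by apply: eq_bigr => k _; rewrite mcoeffD FD.
Qed.

Lemma malg_sumU k a :
  \sum_(j <- msupp (<< a *g k >> : {malg V[K]})) F j << a *g k >>@_j = F k a.
Proof. by rewrite (malg_sumw msuppU_le) big_seq_fset1 mcoeffUU. Qed.

End FreeExtension.

(* The group ring [RG]: finitely supported functions [G -> R] under
   convolution. The ring structure that [monalg] puts on [{malg R[M]}] requires
   a monoid [M] without nontrivial units, hence the separate type. *)

Definition grpring (R : pzRingType) (G : groupType) := {malg R[G]}.

Section GroupRing.
Variables (R : pzRingType) (G : groupType).
Local Notation RG := (grpring R G).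

HB.instance Definition _ := GRing.Zmodule.on RG.

Definition gr_mul (x y : RG) : RG :=
  \sum_(g <- msupp x) \sum_(h <- msupp y) << x@_g * y@_h *g (g * h)%g >>.

Definition gr_one : RG := << 1 *g 1%g >>.

Let mulDl : left_distributive gr_mul +%R.
Proof.
move=> x y z; rewrite /gr_mul.
apply: (@malg_sumD G R RG
  (fun g a => \sum_(h <- msupp z) << a * z@_h *g (g * h)%g >>)) => g a b.
by rewrite -big_split; apply: eq_bigr => h _; rewrite mulrDl monalgUD.
Qed.

Let mulDr : right_distributive gr_mul +%R.
Proof.
move=> x y z; rewrite /gr_mul -big_split; apply: eq_bigr => g _ /=.
apply: (@malg_sumD G R RG (fun h b => << x@_g * b *g (g * h)%g >>)) => h a b.
by rewrite mulrDr monalgUD.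
Qed.

Let mulUU g h a b :
  gr_mul << a *g g >> << b *g h >> = << a * b *g (g * h)%g >>.
Proof.
rewrite /gr_mul (@malg_sumU G R RG
  (fun g a => \sum_(k <- msupp (<< b *g h >> : {malg R[G]}))
     << a * << b *g h >>@_k *g (g * k)%g >>)).
  apply: (@malg_sumU G R RG (fun h b => << a * b *g (g * h)%g >>)) => k c d.
  by rewrite mulrDr monalgUD.
move=> k c d; rewrite -big_split; apply: eq_bigr => l _.
by rewrite mulrDl monalgUD.
Qed.

Let eq_monomial (f1 f2 : RG -> RG) :
    {morph f1 : x y / x + y} -> {morph f2 : x y / x + y} ->
  (forall g a, f1 << a *g g >> = f2 << a *g g >>) -> f1 =1 f2.
Proof.
move=> D1 D2 E x.
have f0 (f : RG -> RG) : {morph f : x y / x + y} -> f 0 = 0.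
  by move=> D; apply: (@addrI RG (f 0)); rewrite -D !addr0.
rewrite [x]monalgE (big_morph f1 D1 (f0 _ D1)) (big_morph f2 D2 (f0 _ D2)).
exact: eq_bigr.
Qed.

Let mulA : associative gr_mul.
Proof.
move=> x y z; apply: (eq_monomial (f1 := fun x => gr_mul x (gr_mul y z))
  (f2 := fun x => gr_mul (gr_mul x y) z)) x => [u v|u v|g a].
- by rewrite mulDl.
- by rewrite !mulDl.
apply: (eq_monomial (f1 := fun y => gr_mul _ (gr_mul y z))
  (f2 := fun y => gr_mul (gr_mul _ y) z)) y => [u v|u v|h b].
- by rewrite mulDl mulDr.
- by rewrite mulDr mulDl.
apply: (eq_monomial (f1 := fun z => gr_mul _ (gr_mul _ z))
  (f2 := gr_mul _)) z => [u v|u v|k c].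
- by rewrite !mulDr.
- by rewrite mulDr.
by rewrite !mulUU mulrA mulgA.
Qed.

Let mul1x : left_id gr_one gr_mul.
Proof.
by apply: eq_monomial => [u v|//|g a]; rewrite ?mulDr // mulUU mul1r mul1g.
Qed.

Let mulx1 : right_id gr_one gr_mul.
Proof.
apply: (eq_monomial (f1 := gr_mul^~ gr_one)) => [u v|//|g a].
  exact: mulDl.
by rewrite mulUU mulr1 mulg1.
Qed.

HB.instance Definition _ := GRing.Zmodule_isPzRing.Build RG
  mulA mul1x mulx1 mulDl mulDr.

Definition gr_incl (r : R) : RG := << r *g 1%g >>.

Let incl_zmod : zmod_morphism gr_incl.
Proof. by move=> a b; rewrite /gr_incl monalgUB. Qed.

Let incl_monoid : monoid_morphism gr_incl.
Proof. by split=> // a b; rewrite /gr_incl [RHS]mulUU mulg1. Qed.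

HB.instance Definition _ := GRing.isZmodMorphism.Build R RG gr_incl incl_zmod.
HB.instance Definition _ := GRing.isMonoidMorphism.Build R RG gr_incl incl_monoid.

End GroupRing.

Arguments gr_incl : clear implicits.

(* The abelian group with generators [X] and relators [r]. *)

Section Presentation.
Variables (X : choiceType) (r : {malg int[X]} -> Prop).

Definition relspan : {pred {malg int[X]}} := fun x =>
  `[< forall S : {pred {malg int[X]}}, GRing.zmod_closed S ->
      (forall y, r y -> y \in S) -> x \in S >].

Let relspan_closed : GRing.zmod_closed relspan.
Proof.
split; first by apply/asboolP => S [].
move=> x y /asboolP hx /asboolP hy; apply/asboolP => S cS rS.
by case: (cS) => _; apply; [exact: hx|exact: hy].
Qed.

HB.instance Definition _ :=
  GRing.isZmodClosed.Build {malg int[X]} relspan relspan_closed.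

Definition presented := Quotient.quot relspan.

HB.instance Definition _ := GRing.Zmodule.on presented.
HB.instance Definition _ := Quotient.on presented.

Definition gen (x : X) : presented := \pi_presented << 1 *g x >>.

Lemma relspan_rel y : r y -> y \in relspan.
Proof. by move=> ry; apply/asboolP => S _; apply. Qed.

Lemma pi_rel y : r y -> \pi_presented y = 0.
Proof.
move=> /relspan_rel ry; rewrite -(raddf0 \pi_presented); apply/eqP.
by rewrite -Quotient.idealrBE subr0.
Qed.

Lemma gen_rel x y z : r (<< x >> - << y >> - << z >>) -> gen x = gen y + gen z.
Proof.
move=> /pi_rel E; apply/eqP; rewrite -subr_eq0 opprD addrA.
by rewrite /gen -!raddfB /= E.
Qed.

Variables (A : zmodType) (f : X -> A).

Definition fext (x : {malg int[X]}) : A := \sum_(k <- msupp x) f k *~ x@_k.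

Lemma fextU k : fext << 1 *g k >> = f k.
Proof.
rewrite /fext (malg_sumU (F := fun k n => f k *~ n)) // => j a b.
exact: mulrzDr.
Qed.

Lemma fext_is_zmod_morphism : zmod_morphism fext.
Proof.
have D : {morph fext : x y / x + y}.
  apply: (malg_sumD (F := fun k n => f k *~ n)) => k a b; exact: mulrzDr.
by move=> x y; apply: (addIr (fext y)); rewrite -D !subrK.
Qed.

HB.instance Definition _ :=
  GRing.isZmodMorphism.Build {malg int[X]} A fext fext_is_zmod_morphism.

Lemma fext_rel x y z :
  f x = f y + f z -> fext (<< x >> - << y >> - << z >>) = 0.
Proof. by move=> E; rewrite !raddfB /= !fextU E -addrA -opprD subrr. Qed.

(* Meaningful when [f] kills the relators, see [pres_lift_gen] and
   [pres_lift_is_zmod_morphism]. *)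
Definition pres_lift (z : presented) : A := fext (repr z).

Hypothesis fr : forall y, r y -> fext y = 0.

Lemma pres_lift_pi x : pres_lift (\pi_presented x) = fext x.
Proof.
apply/eqP; rewrite -subr_eq0 -raddfB /=.
have: repr (\pi_presented x) - x \in relspan.
  by rewrite Quotient.idealrBE reprK.
move=> /asboolP /(_ [pred y | fext y == 0]); apply; last by move=> y /fr /eqP.
split=> [|u v]; rewrite !inE ?raddf0 // => /eqP u0 /eqP v0.
by rewrite raddfB /= u0 v0 subr0.
Qed.

Lemma pres_lift_gen x : pres_lift (gen x) = f x.
Proof. by rewrite pres_lift_pi fextU. Qed.

Lemma pres_lift_is_zmod_morphism : zmod_morphism pres_lift.
Proof.
move=> x y; rewrite -[x]reprK -[y]reprK.
have <- : \pi_presented (repr x - repr y) =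
    \pi_presented (repr x) - \pi_presented (repr y) by rewrite raddfB.
by rewrite !pres_lift_pi raddfB.
Qed.

End Presentation.

(* [A (x) B] over the integers. *)

Section Tensor.
Variables A B : zmodType.

Variant tensor_rel : {malg int[(A * B)%type]} -> Prop :=
| TensorDl a a' b :
    tensor_rel (<< (a + a', b) >> - << (a, b) >> - << (a', b) >>)
| TensorDr a b b' :
    tensor_rel (<< (a, b + b') >> - << (a, b) >> - << (a, b') >>).

Definition tensor := presented tensor_rel.
HB.instance Definition _ := GRing.Zmodule.on tensor.

Definition tens (a : A) (b : B) : tensor := gen tensor_rel (a, b).

Lemma tensDl a a' b : tens (a + a') b = tens a b + tens a' b.
Proof. exact: gen_rel (TensorDl _ _ _). Qed.

Lemma tensDr a b b' : tens a (b + b') = tens a b + tens a b'.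
Proof. exact: gen_rel (TensorDr _ _ _). Qed.

End Tensor.

Section TensorMap.
Variables (A A' B B' : zmodType).
Variables (f : {additive A -> A'}) (g : {additive B -> B'}).

Definition tensor_map : tensor A B -> tensor A' B' :=
  pres_lift (fun p => tens (f p.1) (g p.2)).

Let tensor_map_rel y :
  tensor_rel y -> fext (fun p => tens (f p.1) (g p.2)) y = 0.
Proof.
case=> [a a' b|a b b']; apply: fext_rel; rewrite /= raddfD.
  exact: tensDl.
exact: tensDr.
Qed.

Lemma tensor_map_tens a b : tensor_map (tens a b) = tens (f a) (g b).
Proof. exact: (pres_lift_gen tensor_map_rel). Qed.

HB.instance Definition _ := GRing.isZmodMorphism.Build
  (tensor A B) (tensor A' B') tensor_map
  (pres_lift_is_zmod_morphism tensor_map_rel).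

End TensorMap.

Definition lmod_iso (R : pzRingType) (M N : lmodType R) : Prop :=
  exists phi : {linear M -> N}, bijective phi.

(* A finitely generated projective left [R]-module, as a direct summand of some
   [R^n]: the image [R^n e] of an idempotent matrix acting on row vectors. By
   [fgproj_complete] every direct summand of some [R^n] is isomorphic to one of
   these. *)

Section FGProjective.
Variable R : pzRingType.

Definition fgproj := {n : nat & {e : 'M[R]_n | e *m e == e}}.
HB.instance Definition _ := Choice.on fgproj.

Definition fgrank (P : fgproj) : nat := tag P.
Definition fgidem (P : fgproj) : 'M[R]_(fgrank P) := val (tagged P).

Lemma fgidemK P : fgidem P *m fgidem P = fgidem P.
Proof. exact/eqP/(valP (tagged P)). Qed.

Section Module.
Variable P : fgproj.

Definition in_fgmod : {pred 'rV[R]_(fgrank P)} := fun v => v *m fgidem P == v.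

Let in_fgmod_closed : GRing.submod_closed in_fgmod.
Proof.
split=> [|a u v /eqP hu /eqP hv]; first by rewrite /in_fgmod unfold_in mul0mx.
by apply/eqP; rewrite mulmxDl -scalemxAl hu hv.
Qed.

HB.instance Definition _ :=
  GRing.isSubmodClosed.Build R 'rV[R]_(fgrank P) in_fgmod in_fgmod_closed.

Record fgmod := FGMod { fgval : 'rV[R]_(fgrank P); _ : fgval \in in_fgmod }.

HB.instance Definition _ := [isSub for fgval].
HB.instance Definition _ := [Choice of fgmod by <:].
HB.instance Definition _ := [SubChoice_isSubLmodule of fgmod by <:].

Lemma fgvalK (u : fgmod) : fgval u *m fgidem P = fgval u.
Proof. exact/eqP/(valP u). Qed.

Let fgpr_subproof (v : 'rV[R]_(fgrank P)) : v *m fgidem P \in in_fgmod.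
Proof. by apply/eqP; rewrite -mulmxA fgidemK. Qed.

Definition fgpr (v : 'rV[R]_(fgrank P)) : fgmod := FGMod (fgpr_subproof v).

Lemma fgprK : cancel fgval fgpr.
Proof. by move=> u; apply/val_inj; rewrite /= fgvalK. Qed.

Let fgpr_linear : linear fgpr.
Proof.
by move=> a u v; apply/val_inj; rewrite !linearP /= mulmxDl -scalemxAl.
Qed.

HB.instance Definition _ :=
  GRing.isLinear.Build R 'rV[R]_(fgrank P) fgmod *:%R fgpr fgpr_linear.

Lemma fgval_linear : linear fgval.
Proof. exact: (@linearP _ _ _ _ \val). Qed.

End Module.

Lemma linear_mxP m n (g : 'rV[R]_m -> 'rV[R]_n) :
  linear g -> exists A : 'M[R]_(m, n), forall v, v *m A = g v.
Proof.
move=> lg; pose gL := GRing.isLinear.Build R _ _ *:%R g lg.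
pose g' : {linear 'rV[R]_m -> 'rV[R]_n} := HB.pack g gL.
by exists (lin1_mx g') => v; rewrite mul_rV_lin1.
Qed.

Lemma eq_mul_rV m n (A B : 'M[R]_(m, n)) :
  (forall v : 'rV_m, v *m A = v *m B) -> A = B.
Proof. by move=> E; apply/row_matrixP => i; rewrite !rowE. Qed.

Lemma fgproj_complete (M : lmodType R) n (i : {linear M -> 'rV[R]_n})
    (p : {linear 'rV[R]_n -> M}) :
  cancel i p -> exists P : fgproj, lmod_iso (fgmod P) M.
Proof.
move=> ipK; have [e eE] := @linear_mxP n n (i \o p) (linearP _).
have ee : e *m e == e.
  by apply/eqP/eq_mul_rV => v; rewrite mulmxA !eE /= ipK.
pose P : fgproj := Tagged (fun n => {e : 'M[R]_n | e *m e == e}) (exist _ e ee).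
have lp : linear (fun u : fgmod P => p (fgval u)).
  by move=> a u v; rewrite fgval_linear linearP.
pose pL := GRing.isLinear.Build R (fgmod P) M *:%R _ lp.
pose p' : {linear fgmod P -> M} := HB.pack (fun u : fgmod P => p (fgval u)) pL.
exists P, p', (fun m => @fgpr P (i m)) => [u|m] /=.
  by apply/val_inj; rewrite /= -[LHS]/(i _ *m e) eE /= ipK -[RHS]fgvalK [RHS]eE.
by rewrite -[fgidem P]/e eE /= !ipK.
Qed.

Lemma fgmod_dsumP (P P1 P2 : fgproj) :
  lmod_iso (fgmod P) (fgmod P1 * fgmod P2)%type <->
  exists (a : 'M_(fgrank P, fgrank P1)) (b : 'M_(fgrank P, fgrank P2))
         (c : 'M_(fgrank P1, fgrank P)) (d : 'M_(fgrank P2, fgrank P)),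
  [/\ fgidem P *m (a *m c + b *m d) = fgidem P,
      fgidem P1 *m c *m a = fgidem P1 /\ fgidem P1 *m c *m b = 0,
      fgidem P2 *m d *m a = 0 /\ fgidem P2 *m d *m b = fgidem P2,
      a *m fgidem P1 = a /\ b *m fgidem P2 = b
    & c *m fgidem P = c /\ d *m fgidem P = d].
Proof.
split=> [[phi [psi phiK psiK]]|[a [b [c [d [abcd [ca cb] [da db] [a1 b2] [ce de]]]]]]].
  have lpsi : linear psi.
    by move=> k u v; rewrite -{1}[u]psiK -{1}[v]psiK -linearP phiK.
  have [|a aE] := @linear_mxP _ _ (fun v => fgval (phi (fgpr v)).1).
    by move=> k u v; rewrite !linearP.
  have [|b bE] := @linear_mxP _ _ (fun v => fgval (phi (fgpr v)).2).
    by move=> k u v; rewrite !linearP.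
  have [|c cE] := @linear_mxP _ _ (fun v => fgval (psi (fgpr v, 0))).
    move=> k u v; rewrite -fgval_linear -lpsi; congr (fgval (psi _)).
    by rewrite linearP; congr pair; rewrite /= scaler0 addr0.
  have [|d dE] := @linear_mxP _ _ (fun v => fgval (psi (0, fgpr v))).
    move=> k u v; rewrite -fgval_linear -lpsi; congr (fgval (psi _)).
    by rewrite linearP; congr pair; rewrite /= scaler0 addr0.
  have fgprE (Q : fgproj) v : v *m fgidem Q = fgval (@fgpr Q v) by [].
  have psiD x y : psi (x, 0) + psi (0, y) = psi (x, y).
    rewrite -[psi (x, 0)]scale1r -lpsi scale1r; congr (psi _).
    by congr pair; rewrite ?addr0 ?add0r.
  have fgvalD (Q : fgproj) (x y : fgmod Q) : fgval x + fgval y = fgval (x + y).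
    by rewrite -[x in RHS]scale1r fgval_linear scale1r.
  exists a, b, c, d; split; [|split|split|split|split];
    apply: eq_mul_rV => v; rewrite ?mulmx0 ?mulmxDr !mulmxA.
  - by rewrite fgprE !(aE, bE, cE, dE) !fgprK fgvalD psiD -surjective_pairing phiK.
  - by rewrite fgprE cE aE !fgprK psiK.
  - by rewrite fgprE cE bE !fgprK psiK.
  - by rewrite fgprE dE aE !fgprK psiK.
  - by rewrite fgprE dE bE !fgprK psiK.
  - by rewrite aE fgvalK.
  - by rewrite bE fgvalK.
  - by rewrite cE fgvalK.
  - by rewrite dE fgvalK.
pose phi (u : fgmod P) : (fgmod P1 * fgmod P2)%type :=
  (fgpr (fgval u *m a), fgpr (fgval u *m b)).
have lphi : linear phi.
  move=> k u v; rewrite /phi fgval_linear !mulmxDl -!scalemxAl.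
  by congr pair; rewrite linearP.
pose phiL := GRing.isLinear.Build R _ _ *:%R phi lphi.
pose phi' : {linear fgmod P -> (fgmod P1 * fgmod P2)%type} := HB.pack phi phiL.
exists phi', (fun x => fgpr (fgval x.1 *m c + fgval x.2 *m d)).
  move=> u; apply/val_inj => /=.
  rewrite -!(mulmxA _ a) -!(mulmxA _ b) a1 b2 -!mulmxA -mulmxDr.
  by rewrite -(fgvalK u) -!mulmxA (mulmxA (fgidem P)) abcd fgidemK.
move=> [u w].
have E : (fgval u *m c + fgval w *m d) *m fgidem P =
    fgval u *m c + fgval w *m d by rewrite mulmxDl -!mulmxA ce de.
congr pair; apply/val_inj; rewrite /= E -mulmxA ?a1 ?b2 mulmxDl.
  rewrite -(fgvalK u) -(fgvalK w) -!mulmxA (mulmxA _ c a) (mulmxA _ d a) ca da.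
  by rewrite mulmx0 addr0.
rewrite -(fgvalK u) -(fgvalK w) -!mulmxA (mulmxA _ c b) (mulmxA _ d b) cb db.
by rewrite mulmx0 add0r.
Qed.

(* [K_0(R)]: generators [[P]], relators [[P] - [P1] - [P2]] whenever
   [P] is isomorphic to the direct sum of [P1] and [P2]. Taking [P1] or [P2] to be
   the zero module, isomorphic modules have equal classes. *)

Variant k0_rel : {malg int[fgproj]} -> Prop :=
| K0Rel (P P1 P2 : fgproj) :
    lmod_iso (fgmod P) (fgmod P1 * fgmod P2)%type ->
    k0_rel (<< P >> - << P1 >> - << P2 >>).

Definition K0 := presented k0_rel.
HB.instance Definition _ := GRing.Zmodule.on K0.

Definition k0_class (P : fgproj) : K0 := gen k0_rel P.

Lemma k0_classD (P P1 P2 : fgproj) :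
  lmod_iso (fgmod P) (fgmod P1 * fgmod P2)%type ->
  k0_class P = k0_class P1 + k0_class P2.
Proof. by move=> iso; exact: gen_rel (K0Rel iso). Qed.

End FGProjective.

(* Extension of scalars of left modules along [f]: [S (x)_R (R^n e)] is
   [S^n (f e)], see [base_change_universal]. *)

Section BaseChange.
Variables (R S : pzRingType) (f : {rmorphism R -> S}).

Let base_change_subproof (P : fgproj R) :
  map_mx f (fgidem P) *m map_mx f (fgidem P) == map_mx f (fgidem P).
Proof. by rewrite -map_mxM fgidemK. Qed.

Definition base_change (P : fgproj R) : fgproj S :=
  Tagged (fun n => {e : 'M[S]_n | e *m e == e})
    (exist _ (map_mx f (fgidem P)) (base_change_subproof P)).

Definition base_change_unit (P : fgproj R) (u : fgmod P) :
  fgmod (base_change P) := @fgpr S (base_change P) (map_mx f (fgval u)).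

Lemma base_change_universal (P : fgproj R) (N : lmodType S) (g : fgmod P -> N) :
  zmod_morphism g -> (forall a u, g (a *: u) = f a *: g u) ->
  exists! h : fgmod (base_change P) -> N,
    linear h /\ forall u, h (base_change_unit u) = g u.
Proof.
move=> gB gZ; pose gA := GRing.isZmodMorphism.Build _ _ g gB.
pose g' : {additive fgmod P -> N} := HB.pack g gA.
pose d i : fgmod P := fgpr (delta_mx 0 i).
have gE v : g (fgpr v) = \sum_i f (v 0 i) *: g (d i).
  rewrite [v in LHS]row_sum_delta raddf_sum -[LHS]/(g' _) raddf_sum.
  by apply: eq_bigr => i _; rewrite /= linearZ /= gZ.
pose h (w : fgmod (base_change P)) := \sum_i fgval w 0 i *: g (d i).
have hl : linear h.
  move=> a u v; rewrite /h fgval_linear scaler_sumr -big_split.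
  by apply: eq_bigr => i _; rewrite !mxE scalerDl scalerA.
have unitE u : fgval (base_change_unit u) = map_mx f (fgval u).
  by rewrite /= -map_mxM fgvalK.
have hu u : h (base_change_unit u) = g u.
  rewrite -[u in RHS]fgprK gE /h unitE.
  by apply: eq_bigr => i _; rewrite !mxE.
exists h; split=> // h' [h'l h'u]; apply/funext => w.
have -> : w = \sum_i fgval w 0 i *: base_change_unit (d i).
  rewrite -[w in LHS]fgprK [fgval w in LHS]row_sum_delta raddf_sum.
  apply: eq_bigr => i _; rewrite /= linearZ; congr (_ *: _).
  by apply/val_inj; rewrite [RHS]unitE /= map_mxM map_delta_mx.
pose hL := GRing.isLinear.Build S _ _ *:%R h hl.
pose h1 : {linear fgmod (base_change P) -> N} := HB.pack h hL.
pose h'L := GRing.isLinear.Build S _ _ *:%R h' h'l.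
pose h2 : {linear fgmod (base_change P) -> N} := HB.pack h' h'L.
rewrite -[LHS]/(h1 _) -[RHS]/(h2 _) !raddf_sum.
by apply: eq_bigr => i _; rewrite [LHS]linearZ [RHS]linearZ /= hu h'u.
Qed.

Lemma base_change_dsum (P P1 P2 : fgproj R) :
  lmod_iso (fgmod P) (fgmod P1 * fgmod P2)%type ->
  lmod_iso (fgmod (base_change P))
    (fgmod (base_change P1) * fgmod (base_change P2))%type.
Proof.
move=> /fgmod_dsumP [a [b [c [d [abcd [ca cb] [da db] [a1 b2] [ce de]]]]]].
apply/fgmod_dsumP.
exists (map_mx f a), (map_mx f b), (map_mx f c), (map_mx f d).
by rewrite -[fgidem (base_change P)]/(map_mx f (fgidem P))
  -[fgidem (base_change P1)]/(map_mx f (fgidem P1))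
  -[fgidem (base_change P2)]/(map_mx f (fgidem P2))
  -!map_mxM -map_mxD -!map_mxM abcd ca cb da db a1 b2 ce de !map_mx0.
Qed.

Definition K0_map : K0 R -> K0 S :=
  pres_lift (fun P => k0_class (base_change P)).

Let K0_map_rel y :
  k0_rel y -> fext (fun P => k0_class (base_change P)) y = 0.
Proof. by case=> P P1 P2 /base_change_dsum /k0_classD E; apply: fext_rel. Qed.

Lemma K0_map_class P : K0_map (k0_class P) = k0_class (base_change P).
Proof. exact: (pres_lift_gen K0_map_rel). Qed.

HB.instance Definition _ := GRing.isZmodMorphism.Build (K0 R) (K0 S) K0_map
  (pres_lift_is_zmod_morphism K0_map_rel).

Definition K0Q_map : tensor (K0 R) rat -> tensor (K0 S) rat :=
  tensor_map K0_map (idfun : {additive rat -> rat}).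
HB.instance Definition _ := GRing.Additive.on K0Q_map.

End BaseChange.

(* Main.v *)
Require Import Defs.
From HB Require Import structures.
From mathcomp Require Import all_boot all_order perm all_algebra.
From mathcomp Require Import finmap boolp monalg algC zify ring.

Set Implicit Arguments.
Unset Strict Implicit.
Unset Printing Implicit Defensive.

Import Order.TTheory GRing.Theory Num.Theory.

Local Open Scope ring_scope.

(** Let [p] be an idempotent of [RG] and let [eps : RG -> R] be the augmentation.
   Since [eps p] is [0] or [1], replacing [p] by [1 - p] reduces the claim to:
   if [eps p = 0] then [p = 0]. The augmentation retracts the inclusion
   [R -> RG], so on [K_0 (x) Q] it inverts the induced bijection; as it sends
   the class of [p] to the class of the zero module, [[p] (x) 1] vanishes, that
   is, [k [p] = 0] in [K_0(RG)] for some [k >= 1] ([idempotent_class_torsion]).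
   Each of the three conditions turns this into [p = 0].

   If [RG] is stably finite: writing [P] for the module of [p], the equation
   [k [p] = 0] means that [P^k (+) RG^n] is isomorphic to [RG^n] for some [n]
   ([k0_class_torsion]). Read as matrices, the isomorphism gives square [A], [B]
   with [A B = 1], and [B A = 1] forces [P = 0] ([stably_finite_iso]).

   If [R] is a skew field and [G] is sofic, then [RG] is stably finite
   ([sofic_stably_finite], the argument of Elek and Szabo): a sofic
   approximation [G -> Sym(n)] turns [m x m] matrices over [RG] into [mn x mn]
   matrices over [R], multiplicatively in all but a small proportion of the
   rows. A nonzero entry of [B A - 1] would give a number of independent rows
   that is at least a fixed fraction of [n], whereas [A B = 1] bounds it by the
   number of bad rows ([skew_defect_bound]).

   If [R] is a field of characteristic zero, the coefficient at [1] of the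
   matrix trace is a homomorphism [K_0(RG) -> R], so [k [p] = 0] gives [p@_1 = 0],
   and by a theorem of Kaplansky this implies [p = 0]. A system of polynomial
   equations and one inequation with integer coefficients that is solvable in [R]
   is solvable in the algebraic numbers ([specializable_seq]); applied to the
   coefficients of [p], this moves the question to [algC]. There [CG] has a
   positive definite inner product, and comparing [p] with a near-orthogonal
   projection of [1] onto the right ideal [p CG] bounds the norm of [p] by
   arbitrarily small numbers ([idempotent_nrm_small]). *)

(** * Group rings *)

Section GroupRingTheory.
Variables (R : pzRingType) (G : groupType).
Local Notation RG := (grpring R G).

Lemma grpring_sum (x : RG) : x = \sum_(g <- msupp x) << x@_g *g g >> :> RG.
Proof. exact: monalgE. Qed.

Section Lift.
Variables (A : zmodType) (F : G -> R -> A).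
Hypothesis FD : forall g a b, F g (a + b) = F g a + F g b.

Definition gr_lift (x : RG) : A := \sum_(g <- msupp x) F g x@_g.

Lemma gr_liftD x y : gr_lift (x + y) = gr_lift x + gr_lift y.
Proof. exact: (malg_sumD FD). Qed.

Lemma gr_liftU g a : gr_lift << a *g g >> = F g a.
Proof. exact: (malg_sumU FD). Qed.

End Lift.

Lemma gr_mulE (x y : RG) :
  x * y = \sum_(g <- msupp x) \sum_(h <- msupp y)
    << x@_g * y@_h *g (g * h)%g >> :> RG.
Proof. by []. Qed.

Lemma gr_mulUU g h a b :
  (<< a *g g >> : RG) * << b *g h >> = << a * b *g (g * h)%g >> :> RG.
Proof.
rewrite gr_mulE (@malg_sumU G R RG
  (fun g a => \sum_(k <- msupp (<< b *g h >> : {malg R[G]}))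
     << a * << b *g h >>@_k *g (g * k)%g >>)).
  apply: (@malg_sumU G R RG (fun h b => << a * b *g (g * h)%g >>)) => k c d.
  by rewrite mulrDr monalgUD.
move=> k c d; rewrite -big_split; apply: eq_bigr => l _.
by rewrite mulrDl monalgUD.
Qed.

Lemma gr_1E : 1 = << 1 *g 1%g >> :> RG.
Proof. by []. Qed.

(** Identities between additive functions of group ring elements, such as the
   multiplicativity of a map, may be checked on monomials, because these generate
   the group ring additively. *)
Lemma eq_additive_on_monomials (A : zmodType) (f1 f2 : RG -> A) :
    {morph f1 : x y / x + y} -> {morph f2 : x y / x + y} ->
  (forall g a, f1 << a *g g >> = f2 << a *g g >>) -> f1 =1 f2.
Proof.
move=> D1 D2 E x.
have f0 (f : RG -> A) : {morph f : x y / x + y} -> f 0 = 0.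
  by move=> D; apply: (addrI (f 0)); rewrite -D !addr0.
rewrite (grpring_sum x) (big_morph f1 D1 (f0 _ D1)) (big_morph f2 D2 (f0 _ D2)).
exact: eq_bigr.
Qed.

Lemma gr_rmorphism (S : pzRingType) (F : G -> R -> S) :
    (forall g a b, F g (a + b) = F g a + F g b) ->
    (forall g h a b, F (g * h)%g (a * b) = F g a * F h b) ->
    F 1%g 1 = 1 ->
  {f : {rmorphism RG -> S} | forall g a, f << a *g g >> = F g a}.
Proof.
move=> FD FM F1.
have fD := gr_liftD FD; have fU := gr_liftU FD.
have fB : zmod_morphism (gr_lift F).
  by move=> x y; apply: (addIr (gr_lift F y)); rewrite -fD !subrK.
have fM : monoid_morphism (gr_lift F).
  split=> [|x y]; first by rewrite gr_1E fU.
  move: x; apply: eq_additive_on_monomials => [u v|u v|g a].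
  - by rewrite mulrDl fD.
  - by rewrite fD mulrDl.
  move: y; apply: eq_additive_on_monomials => [u v|u v|h b].
  - by rewrite mulrDr fD.
  - by rewrite fD mulrDr.
  by rewrite gr_mulUU !fU.
pose fA := GRing.isZmodMorphism.Build _ _ (gr_lift F) fB.
pose fL := GRing.isMonoidMorphism.Build _ _ (gr_lift F) fM.
pose f : {rmorphism RG -> S} := HB.pack (gr_lift F) fA fL.
by exists f.
Qed.

Lemma augmentation_exists :
  {eps : {rmorphism RG -> R} | forall g a, eps << a *g g >> = a}.
Proof. exact: (gr_rmorphism (F := fun _ a => a)). Qed.

End GroupRingTheory.

Lemma gr_map_exists (R S : pzRingType) (G : groupType)
    (f : {rmorphism R -> S}) :
  {F : {rmorphism grpring R G -> grpring S G} | forall x g, (F x)@_g = f x@_g}.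
Proof.
have [|g h a b||F FU] :=
    @gr_rmorphism R G (grpring S G) (fun g a => << f a *g g >>).
- by move=> g a b; rewrite rmorphD monalgUD.
- by rewrite gr_mulUU rmorphM.
- by rewrite rmorph1.
exists F => x g.
apply: (eq_additive_on_monomials (f1 := fun x => (F x)@_g)
  (f2 := fun x => f x@_g)) x => [x y|x y|h a].
- by rewrite rmorphD mcoeffD.
- by rewrite mcoeffD rmorphD.
by rewrite FU !mcoeffU rmorphMn.
Qed.

(** The coefficient at [1] is a trace over a commutative ring, since [g h = 1] if
   and only if [h g = 1]. *)
Lemma gr_trC (R : pzRingType) (G : groupType) (x y : grpring R G) :
  (forall a b : R, a * b = b * a) -> (x * y)@_1%g = (y * x)@_1%g.
Proof.
move=> cR; move: x; apply: eq_additive_on_monomials => [u v|u v|g a].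
- by rewrite mulrDl mcoeffD.
- by rewrite mulrDr mcoeffD.
move: y; apply: eq_additive_on_monomials => [u v|u v|h b].
- by rewrite mulrDr mcoeffD.
- by rewrite mulrDl mcoeffD.
rewrite !gr_mulUU !mcoeffU cR; congr (_ *+ nat_of_bool _).
by rewrite !mulg_eq1 [RHS]eq_sym eqg_invLR.
Qed.

(** * Isomorphisms of modules and torsion in K_0 *)

(** All that is needed from a vanishing class in a presented group: it lies in the
   subgroup spanned by the relators, hence in any subgroup that contains them. Both
   descriptions of torsion below come from a well chosen such subgroup, so that
   no localization or Grothendieck group has to be constructed. *)
Lemma pi_eq0_relspan (X : choiceType) (r : {malg int[X]} -> Prop) z :
  \pi_(presented r)%qT z = 0 -> z \in relspan r.
Proof.
move=> z0; rewrite -[z]subr0 Quotient.idealrBE.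
by apply/eqP; rewrite z0 raddf0.
Qed.

Section TensorTorsion.
Variable A : zmodType.

Let scaled (N : int) (p : A * rat) : A := p.1 *~ numq (N%:~R * p.2).

Let integral_mul (N : int) (q : rat) : (denq q %| N)%Z ->
  exists n : int, N%:~R * q = n%:~R.
Proof.
move=> /dvdzP [k ->]; exists (k * numq q).
by rewrite !intrM -mulrA [_ * q]mulrC -numqE.
Qed.

(** The subgroup chosen here consists of the formal sums that vanish in [A] after
   multiplication of the rational components by any sufficiently divisible [M].
   Asking for all multiples of [N], not for [N] alone, makes it closed under
   subtraction; integrality of the products makes it contain the relators. *)
Lemma tens1_eq0 (a : A) : tens a (1 : rat) = 0 -> exists k, a *+ k.+1 = 0.
Proof.
move=> /pi_eq0_relspan /asboolP E.
pose S : {pred {malg int[(A * rat)%type]}} := fun z =>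
  `[< exists2 N : int, N != 0 &
        forall M, M != 0 -> (N %| M)%Z -> fext (scaled M) z = 0 >].
have: << 1 *g (a, 1 : rat) >> \in S.
  apply: E; [split=> [|y z] |].
  - by apply/asboolP; exists 1 => // M _ _; rewrite raddf0.
  - move=> /asboolP [N N0 yN] /asboolP [N' N'0 zN']; apply/asboolP.
    exists (N * N'); first by rewrite mulf_neq0.
    move=> M M0 NM; rewrite raddfB /= yN ?zN' ?subr0 //.
      exact: dvdz_trans (dvdz_mull _ (dvdzz _)) NM.
    exact: dvdz_trans (dvdz_mulr _ (dvdzz _)) NM.
  move=> _ [b b' q|b q q']; apply/asboolP.
    by exists 1 => // M _ _; apply: fext_rel; rewrite /scaled /= mulrzDl.
  exists (denq q * denq q'); first by rewrite mulf_neq0 ?denq_neq0.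
  move=> M M0 NM; apply: fext_rel; rewrite /scaled /= mulrDr.
  have [m ->] : exists m : int, M%:~R * q = m%:~R.
    exact/integral_mul/(dvdz_trans _ NM)/dvdz_mulr.
  have [m' ->] : exists m : int, M%:~R * q' = m%:~R.
    exact/integral_mul/(dvdz_trans _ NM)/dvdz_mull.
  by rewrite -rmorphD /= !numq_int mulrzDr.
move=> /asboolP [N N0 /(_ `|N|%:Z)].
rewrite fextU /scaled mulr1 numq_int eqz_nat absz_eq0 N0 dvdzE /= dvdnn.
move=> /(_ isT isT) Na; exists `|N|.-1; rewrite prednK ?absz_gt0 //.
Qed.

End TensorTorsion.

Section Isomorphisms.
Variable R : pzRingType.
Implicit Types M N L : lmodType R.

Lemma lmod_isoI M N (f : M -> N) (g : N -> M) :
  linear f -> cancel f g -> cancel g f -> lmod_iso M N.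
Proof.
move=> lf fK gK; pose fL := GRing.isLinear.Build R _ _ *:%R f lf.
by exists (HB.pack f fL : {linear M -> N}), g.
Qed.

Lemma lmod_isoE M N : lmod_iso M N ->
  exists (f : {linear M -> N}) (g : {linear N -> M}), cancel f g /\ cancel g f.
Proof.
move=> [f [g fK gK]]; have lg : linear g.
  by move=> a u v; apply: (can_inj fK); rewrite linearP !gK.
pose gL := GRing.isLinear.Build R _ _ *:%R g lg.
by exists f, (HB.pack g gL : {linear N -> M}).
Qed.

Lemma lmod_iso_refl M : lmod_iso M M.
Proof. by exists idfun, id. Qed.

Lemma lmod_iso_sym M N : lmod_iso M N -> lmod_iso N M.
Proof. by move=> /lmod_isoE [f [g [fK gK]]]; exists g, f. Qed.

Lemma lmod_iso_trans M N L : lmod_iso M N -> lmod_iso N L -> lmod_iso M L.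
Proof.
move=> [f [f' fK f'K]] [g [g' gK g'K]].
by exists (g \o f), (f' \o g'); apply: can_comp.
Qed.

Lemma lmod_iso_prod M M' N N' :
  lmod_iso M M' -> lmod_iso N N' -> lmod_iso (M * N)%type (M' * N')%type.
Proof.
move=> [f [f' fK f'K]] [g [g' gK g'K]].
apply: (@lmod_isoI _ _ (fun x => (f x.1, g x.2)) (fun x => (f' x.1, g' x.2))).
- by move=> a [u v] [u' v']; congr pair; rewrite /= linearP.
- by move=> [u v]; rewrite /= fK gK.
- by move=> [u v]; rewrite /= f'K g'K.
Qed.

Lemma lmod_iso_prodC M N : lmod_iso (M * N)%type (N * M)%type.
Proof.
apply: (@lmod_isoI _ _ (fun x => (x.2, x.1)) (fun x => (x.2, x.1))).
- by move=> a [u v] [u' v'].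
- by move=> [u v].
- by move=> [u v].
Qed.

Lemma lmod_iso_prodA M N L : lmod_iso (M * (N * L))%type ((M * N) * L)%type.
Proof.
apply: (@lmod_isoI _ _ (fun x => ((x.1, x.2.1), x.2.2))
  (fun x => (x.1.1, (x.1.2, x.2)))).
- by move=> a [u [v w]] [u' [v' w']].
- by move=> [u [v w]].
- by move=> [[u v] w].
Qed.

Lemma lmod_iso_rV0 M : lmod_iso ('rV[R]_0 * M)%type M.
Proof.
apply: (@lmod_isoI _ _ snd (fun x => (0, x))) => //.
by move=> [u v]; rewrite /= [u]thinmx0.
Qed.

Lemma lmod_iso_rVD m n : lmod_iso ('rV[R]_m * 'rV[R]_n)%type 'rV[R]_(m + n).
Proof.
apply: (@lmod_isoI _ _ (fun x => row_mx x.1 x.2)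
  (fun x => (lsubmx x, rsubmx x))).
- by move=> a [u v] [u' v'] /=; rewrite scale_row_mx add_row_mx.
- by move=> [u v]; rewrite /= row_mxKl row_mxKr.
- by move=> x; rewrite /= hsubmxK.
Qed.

Fixpoint dsum (s : seq (fgproj R)) : lmodType R :=
  if s is P :: s' then (fgmod P * dsum s')%type else 'rV[R]_0.

Lemma dsum_cat s t : lmod_iso (dsum (s ++ t)) (dsum s * dsum t)%type.
Proof.
elim: s => [|P s IHs] /=; first exact/lmod_iso_sym/lmod_iso_rV0.
apply: lmod_iso_trans (lmod_iso_prod (lmod_iso_refl _) IHs) _.
exact: lmod_iso_prodA.
Qed.

Lemma dsum_perm s t : perm_eq s t -> lmod_iso (dsum s) (dsum t).
Proof.
elim: s t => [|P s IHs] t.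
  by rewrite perm_sym => /perm_nilP ->; exact: lmod_iso_refl.
move=> Pst; have tP : P \in t by rewrite -(perm_mem Pst) mem_head.
move: Pst; case/splitPr: tP => t1 t2.
rewrite perm_sym -cat1s perm_catCA perm_cons perm_sym => /IHs sE /=.
apply: lmod_iso_trans (lmod_iso_prod (lmod_iso_refl _) sE) _.
apply: lmod_iso_trans (lmod_iso_prod (lmod_iso_refl _) (dsum_cat _ _)) _.
apply: lmod_iso_trans (lmod_iso_prodA _ _ _) _.
apply: lmod_iso_trans (lmod_iso_prod (lmod_iso_prodC _ _) (lmod_iso_refl _)) _.
apply: lmod_iso_trans (lmod_iso_sym (lmod_iso_prodA _ _ _)) _.
exact/lmod_iso_sym/(dsum_cat t1 (P :: t2)).
Qed.

Definition mk_fgproj n (e : 'M[R]_n) (ee : e *m e = e) : fgproj R :=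
  Tagged (fun n => {e : 'M[R]_n | e *m e == e}) (exist _ e (introT eqP ee)).

Lemma compl_idem n (e : 'M[R]_n) :
  e *m e = e -> (1%:M - e) *m (1%:M - e) = 1%:M - e.
Proof. by move=> ee; rewrite mulmxBl mul1mx mulmxBr mulmx1 ee subrr subr0. Qed.

Definition fgcompl (P : fgproj R) : fgproj R :=
  mk_fgproj (compl_idem (fgidemK P)).

Lemma fgcompl_iso P :
  lmod_iso (fgmod P * fgmod (fgcompl P))%type 'rV[R]_(fgrank P).
Proof.
have idE v : v *m fgidem (fgcompl P) = v - v *m fgidem P.
  by rewrite /fgidem /= mulmxBr mulmx1.
have idV (u : fgmod (fgcompl P)) : (fgval u : 'rV_(fgrank P)) *m fgidem P = 0.
  have := fgvalK u; rewrite [fgidem _]/(_ - _).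
  by move=> <-; rewrite -mulmxA mulmxBl mul1mx (fgidemK P) subrr mulmx0.
apply: (@lmod_isoI (fgmod P * fgmod (fgcompl P))%type 'rV[R]_(fgrank P)
  (fun x => (fgval x.1 : 'rV_(fgrank P)) + fgval x.2)
  (fun x => (@fgpr _ P x, @fgpr _ (fgcompl P) x))).
- by move=> a [u v] [u' v']; rewrite !fgval_linear scalerDr addrACA.
- move=> [u v]; congr pair; apply: val_inj => /=.
    by rewrite mulmxDl idV addr0 fgvalK.
  by rewrite idE mulmxDl idV addr0 (fgvalK u) addrAC subrr add0r.
- by move=> x; rewrite /= idE addrC subrK.
Qed.

Lemma dsum_free s : exists t n, lmod_iso (dsum (s ++ t)) 'rV[R]_n.
Proof.
elim: s => [|P s [t [N IH]]]; first by exists [::], 0; exact: lmod_iso_refl.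
exists (fgcompl P :: t), (fgrank P + N)%N.
have E : perm_eq ((P :: s) ++ fgcompl P :: t) (P :: fgcompl P :: s ++ t).
  by rewrite /= perm_cons -cat1s perm_catCA.
apply: lmod_iso_trans (dsum_perm E) _ => /=.
apply: lmod_iso_trans (lmod_iso_prodA _ _ _) _.
apply: lmod_iso_trans (lmod_iso_rVD _ _).
exact: lmod_iso_prod (fgcompl_iso P) IH.
Qed.

Let fsum (s : seq (fgproj R)) : {malg int[fgproj R]} := \sum_(P <- s) << P >>.

Let fsum_cat s t : fsum (s ++ t) = fsum s + fsum t.
Proof. exact: big_cat. Qed.

Let fsum1 P : fsum [:: P] = << P >>.
Proof. exact: big_seq1. Qed.

Let fsum_perm s t : fsum s = fsum t -> perm_eq s t.
Proof.
move=> E; apply/allP => P _ /=; apply/eqP.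
suff C u : (fsum u)@_P = (count_mem P u)%:Z.
  by move: (C s); rewrite E C => -[].
elim: u => [|Q u IHu]; rewrite /fsum ?big_nil ?mcoeff0 // big_cons mcoeffD.
by rewrite [X in _ + X]IHu mcoeffU /= PoszD; case: eqP.
Qed.

(** The subgroup chosen here consists of the differences of two formal sums whose
   direct sums become isomorphic after adding a common summand; it contains the
   relators of [K_0]. When the difference is [k P], the common summand can be
   enlarged to absorb the second direct sum and to become free. *)
Lemma k0_class_torsion (P : fgproj R) k : k0_class P *+ k = 0 ->
  exists n, lmod_iso (dsum (nseq k P) * 'rV[R]_n)%type 'rV[R]_n.
Proof.
rewrite /k0_class /gen -raddfMn => /pi_eq0_relspan /asboolP E.
pose S : {pred {malg int[fgproj R]}} := fun z => `[< exists s t u,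
  z = fsum s - fsum t /\ lmod_iso (dsum (s ++ u)) (dsum (t ++ u)) >].
have: << 1 *g P >> *+ k \in S.
  apply: E.
    split=> [|y z /asboolP [s [t [u [-> i]]]] /asboolP [s' [t' [u' [-> i']]]]].
      apply/asboolP; exists [::], [::], [::]; rewrite subrr; split=> //.
      exact: lmod_iso_refl.
    apply/asboolP; exists (s ++ t'), (t ++ s'), (u ++ u'); split.
      by rewrite !fsum_cat opprB !opprD addrACA.
    have catACA (a b c d : seq (fgproj R)) :
        perm_eq ((a ++ b) ++ (c ++ d)) ((a ++ c) ++ (b ++ d)).
      by rewrite -!catA perm_cat2l perm_catCA.
    apply: lmod_iso_trans (dsum_perm (catACA _ _ _ _)) _.
    apply: lmod_iso_trans (lmod_iso_sym (dsum_perm (catACA _ _ _ _))).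
    apply: lmod_iso_trans (dsum_cat _ _) _.
    apply: lmod_iso_trans (lmod_iso_sym (dsum_cat _ _)).
    exact: lmod_iso_prod i (lmod_iso_sym i').
  move=> _ [Q Q1 Q2 i]; apply/asboolP; exists [:: Q], [:: Q1; Q2], [::]; split.
    by rewrite (fsum_cat [:: Q1] [:: Q2]) !fsum1 opprD addrA.
  apply: lmod_iso_trans (lmod_iso_prod i (lmod_iso_refl _)) _.
  exact/lmod_iso_sym/lmod_iso_prodA.
move=> /asboolP [s [t [u [+ i]]]].
have -> : << 1 *g P >> *+ k = fsum (nseq k P).
  by rewrite /fsum big_nseq -Monoid.iteropE.
move=> /eqP; rewrite eq_sym subr_eq -fsum_cat => /eqP /fsum_perm st.
have [w [N f]] := dsum_free (t ++ u); exists N.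
apply: lmod_iso_trans (lmod_iso_prod (lmod_iso_refl _) (lmod_iso_sym f)) _.
apply: lmod_iso_trans (lmod_iso_sym (dsum_cat _ _)) _.
apply: lmod_iso_trans f.
apply: lmod_iso_trans (lmod_iso_sym (dsum_cat _ _)).
apply: lmod_iso_trans (lmod_iso_prod i (lmod_iso_refl _)).
apply: lmod_iso_trans (dsum_cat _ _).
by apply: dsum_perm; rewrite !catA perm_cat2r perm_cat2r perm_sym.
Qed.

(** The inclusion of [R^n] in [M x R^n] followed by the isomorphism, and the inverse
   isomorphism followed by the projection, are one-sided inverse endomorphisms of
   [R^n]; if they are two-sided inverse, the summand [M] is invisible to the
   isomorphism. *)
Lemma stably_finite_iso M n :
  stably_finite R -> lmod_iso (M * 'rV[R]_n)%type 'rV[R]_n ->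
  forall x : M, x = 0.
Proof.
move=> sf i.
(* One more free summand: [stably_finite] concerns matrices of positive size. *)
have {i} : lmod_iso (M * 'rV[R]_n.+1)%type 'rV[R]_n.+1.
  rewrite -(addn1 n); have Dn := lmod_iso_rVD n 1.
  apply: lmod_iso_trans (lmod_iso_prod (lmod_iso_refl M) (lmod_iso_sym Dn)) _.
  apply: lmod_iso_trans (lmod_iso_prodA _ _ _) _.
  exact: lmod_iso_trans (lmod_iso_prod i (lmod_iso_refl _)) Dn.
move: n.+1 (sf n.+1 isT) => {}n df /lmod_isoE [f [g [fK gK]]].
have [A AE] : exists A : 'M_n, forall v, v *m A = f (0, v).
  apply: linear_mxP => a u v; rewrite -linearP; congr (f _).
  by congr pair; rewrite /= scaler0 addr0.
have [B BE] : exists B : 'M_n, forall v, v *m B = (g v).2.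
  by apply: linear_mxP => a u v; rewrite linearP.
have AB : A *m B = 1%:M.
  by apply: eq_mul_rV => v; rewrite mulmxA AE BE fK mulmx1.
move=> x; have := congr1 (fun C => f (x, 0) *m C) (df _ _ AB).
by rewrite mulmxA BE AE fK /= mulmx1 => /(can_inj fK) [].
Qed.

End Isomorphisms.

(** * Classes of idempotents and the trace *)

Lemma presented_ext (X : choiceType) (r : {malg int[X]} -> Prop) (A : zmodType)
    (f g : {additive presented r -> A}) :
  (forall x, f (gen r x) = g (gen r x)) -> f =1 g.
Proof.
move=> E y; rewrite -[y]reprK [repr y]monalgE !raddf_sum /=.
apply: eq_bigr => x _; move: (repr y)@_x => z.
have -> : << z *g x >> = << 1 *g x >> *~ z :> {malg int[X]}.
  by rewrite -[z in LHS]intz raddfMz.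
by rewrite !raddfMz; congr (_ *~ _); exact: E.
Qed.

Lemma base_change_retract (R S : pzRingType) (f : {rmorphism R -> S})
    (g : {rmorphism S -> R}) (P : fgproj R) :
  cancel f g -> base_change g (base_change f P) = P.
Proof.
move=> fK; case: P => n [e ee]; congr (Tagged _ _); apply: val_inj => /=.
by rewrite /fgidem /=; apply/matrixP => i j; rewrite !mxE fK.
Qed.

Lemma K0_map_retract (R S : pzRingType) (f : {rmorphism R -> S})
    (g : {rmorphism S -> R}) :
  cancel f g -> cancel (K0_map f) (K0_map g).
Proof.
move=> fK.
apply: (presented_ext (f := K0_map g \o K0_map f) (g := idfun)) => P /=.
by rewrite !K0_map_class base_change_retract.
Qed.

Lemma K0Q_map_retract (R S : pzRingType) (f : {rmorphism R -> S})
    (g : {rmorphism S -> R}) :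
  cancel f g -> cancel (K0Q_map f) (K0Q_map g).
Proof.
move=> fK.
apply: (presented_ext (f := K0Q_map g \o K0Q_map f) (g := idfun)) => -[x q].
by rewrite /= -[gen _ _]/(tens x q) /K0Q_map !tensor_map_tens /= K0_map_retract.
Qed.

(** The zero module is its own direct square. *)
Lemma k0_class0 (R : pzRingType) (P : fgproj R) :
  fgidem P = 0 -> k0_class P = 0.
Proof.
move=> P0; apply: (addrI (k0_class P)); rewrite addr0; apply/esym/k0_classD.
apply/fgmod_dsumP; exists 0, 0, 0, 0.
by rewrite P0 !mul0mx.
Qed.

Definition idem_fgproj (R : pzRingType) (p : R) (pp : p * p = p) : fgproj R :=
  @mk_fgproj R 1 p%:M
    (etrans (esym (scalar_mxM 1 p p)) (congr1 (@scalar_mx R 1) pp)).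

(** The class of [p] over [Q] comes from some [y] over [R]; applying [g] recovers
   [y] as the class of [g p = 0]. *)
Lemma idempotent_class_torsion (R S : pzRingType) (f : {rmorphism R -> S})
    (g : {rmorphism S -> R}) (p : S) (pp : p * p = p) :
  cancel f g -> bijective (K0Q_map f) -> g p = 0 ->
  exists k, k0_class (idem_fgproj pp) *+ k.+1 = 0.
Proof.
move=> fK [h _ hK] gp0; apply: tens1_eq0.
rewrite -[tens _ _]hK; set y := h _.
suff -> : y = 0 by rewrite raddf0.
rewrite -[y](K0Q_map_retract fK) {}/y hK /K0Q_map tensor_map_tens /= K0_map_class.
rewrite k0_class0 => [|].
  by apply: (addrI (tens 0 (1 : rat))); rewrite addr0 -tensDl addr0.
by rewrite /fgidem /= map_scalar_mx gp0 raddf0.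
Qed.

Lemma idempotent_eq0_stably_finite (S : pzRingType) (p : S) (pp : p * p = p) k :
  stably_finite S -> k0_class (idem_fgproj pp) *+ k.+1 = 0 -> p = 0.
Proof.
move=> sf /k0_class_torsion [n /=].
set P := idem_fgproj pp => i.
have := congr1 (fun x => fgval x.1)
  (stably_finite_iso sf i (@fgpr _ P 1%:M, 0)).
by rewrite /= mul1mx => /matrixP /(_ 0 0); rewrite !mxE eqxx mulr1n.
Qed.

Section Trace.
Variables (R : pzRingType) (G : groupType).
Hypothesis cR : forall a b : R, a * b = b * a.
Local Notation RG := (grpring R G).

Definition mxtr n (A : 'M[RG]_n) : R := (\tr A)@_1%g.

Lemma mxtrD n (A B : 'M[RG]_n) : mxtr (A + B) = mxtr A + mxtr B.
Proof. by rewrite /mxtr raddfD mcoeffD. Qed.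

Lemma mxtrC m n (A : 'M[RG]_(m, n)) (B : 'M_(n, m)) :
  mxtr (A *m B) = mxtr (B *m A).
Proof.
rewrite /mxtr /mxtrace !raddf_sum /=.
under eq_bigr do rewrite mxE raddf_sum.
rewrite exchange_big; apply: eq_bigr => j _ /=; rewrite mxE raddf_sum.
by apply: eq_bigr => i _; rewrite [LHS](gr_trC _ _ cR).
Qed.

(** With the matrices of a decomposition of [P] into [P1] and [P2], cyclicity moves
   the two halves of the trace of [P] onto [P1] and [P2]. *)
Lemma k0_trace_exists :
  exists T : {additive K0 RG -> R}, forall P, T (k0_class P) = mxtr (fgidem P).
Proof.
have trel y : @k0_rel RG y -> fext (fun P => mxtr (fgidem P)) y = 0.
  case=> P P1 P2 /fgmod_dsumP.
  move=> [a [b [c [d [abcd [ca _] [_ db] [a1 b2] [ce de]]]]]].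
  apply: fext_rel; rewrite -{1}abcd mulmxDr mxtrD.
  congr (_ + _).
    by rewrite mulmxA mxtrC mulmxA ce -a1 mulmxA mxtrC mulmxA ca.
  by rewrite mulmxA mxtrC mulmxA de -b2 mulmxA mxtrC mulmxA db.
pose T0 : K0 RG -> R := pres_lift (fun P => mxtr (fgidem P)).
have T0B : zmod_morphism T0 by exact: pres_lift_is_zmod_morphism trel.
pose TA := GRing.isZmodMorphism.Build (K0 RG) R T0 T0B.
pose T : {additive K0 RG -> R} := HB.pack T0 TA.
by exists T => P; exact: pres_lift_gen.
Qed.

Lemma torsion_trace0 (p : RG) (pp : p * p = p) k :
  k0_class (idem_fgproj pp) *+ k = 0 -> p@_1%g *+ k = 0.
Proof.
have [T TE] := k0_trace_exists.
move=> /(congr1 T); rewrite raddfMn raddf0 TE /mxtr /fgidem /=.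
by rewrite mxtrace_scalar mulr1n.
Qed.

End Trace.

(** * Direct finiteness over sofic groups *)

Section SkewField.
Variable R : pzRingType.
Hypothesis skR : is_skew_field R.

Lemma skew_mulf_eq0 (a b : R) : b != 0 -> a * b = 0 -> a = 0.
Proof.
move=> b0 ab; have [c [bc _]] := skR.2 b b0.
by rewrite -[a]mulr1 -bc mulrA ab mul0r.
Qed.

(** More vectors than coordinates are linearly dependent. This is one column of
   Gaussian elimination at a time: a row [i0] with nonzero entry at [t] clears the
   column [t] from the other rows. Coefficients act on the left, so with [u] a left
   inverse of the pivot, row [i] loses the multiple [w i t * u] of row [i0]. *)
Lemma skew_dependent (I T : finType) (A : {set I}) (B : {set T})
    (w : I -> T -> R) :
  (#|B| < #|A|)%N ->
  exists c : I -> R, [/\ exists i, c i != 0, forall i, i \notin A -> c i = 0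
    & forall t, t \in B -> \sum_i c i * w i t = 0].
Proof.
have [n] := ubnP #|B|; elim: n A B w => // n IHn A B w Bn BA.
have [B0|[t tB]] := set_0Vmem B.
  have [i iA] : exists i, i \in A.
    by apply/set0Pn; rewrite -card_gt0 (leq_trans _ BA).
  exists (fun j => (j == i)%:R); split=> [|j jA|t]; last by rewrite B0 inE.
    by exists i; rewrite eqxx skR.1.
  by case: eqP jA => // ->; rewrite iA.
have Bt : (#|B :\ t|.+1 = #|B|)%N by rewrite (cardsD1 t B) tB.
case: (pickP [pred i in A | w i t != 0]) => [i0 /andP [/= i0A wi0]|w0]; last first.
  have [||c [c0 cA cB]] := IHn A (B :\ t) w; first by rewrite -ltnS Bt.
    by rewrite -Bt in BA; exact: ltnW.
  exists c; split=> // s sB.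
  have [->|st] := eqVneq s t; last by rewrite cB // !inE st.
  apply: big1 => i _.
  have [iA|iA] := boolP (i \in A); last by rewrite cA ?mul0r.
  by have /= := w0 i; rewrite iA => /negbFE /eqP ->; rewrite mulr0.
have [u [_ uw]] := skR.2 _ wi0.
pose w' i s := w i s - w i t * u * w i0 s.
have [||c [[i ci] cA cB]] := IHn (A :\ i0) (B :\ t) w'.
- by rewrite -ltnS Bt.
- by rewrite -ltnS Bt; move: BA; rewrite (cardsD1 i0 A) i0A.
pose d := - \sum_i c i * w i t * u.
have ci0 : c i0 = 0 by apply: cA; rewrite !inE eqxx.
have ii0 : i != i0 by apply: contraNneq ci => ->; rewrite ci0.
exists (fun j => if j == i0 then d else c j); split=> [|j jA|s sB].
- by exists i; rewrite (negPf ii0).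
- by case: eqP jA => [->|_ jA]; rewrite ?i0A // cA // !inE (negPf jA) andbF.
have -> : \sum_j (if j == i0 then d else c j) * w j s = \sum_j c j * w' j s.
  rewrite /w'; under [RHS]eq_bigr do rewrite mulrBr !mulrA.
  rewrite sumrB -mulr_suml -mulNr -/d.
  under eq_bigr => j _.
    have -> : (if j == i0 then d else c j) = c j + (if j == i0 then d else 0).
      by case: eqP => [->|]; rewrite ?ci0 ?add0r ?addr0.
    rewrite mulrDl; over.
  rewrite big_split; congr (_ + _) => /=.
  rewrite (bigD1 i0) //= eqxx big1 ?addr0 // => j /negPf ->.
  by rewrite mul0r.
have [->|st] := eqVneq s t; last by apply: cB; rewrite !inE st.
by apply: big1 => j _; rewrite /w' -!mulrA uw mulr1 subrr mulr0.
Qed.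



(** The bound behind direct finiteness. Row vectors [u] supported off [B1] satisfy
   [u X Y = u], so the space of the [u X] has codimension at most [#|B1|] and
   [Y X] is the identity on it. Row vectors [v <> 0] supported on [J] and off [B2]
   satisfy [v Y X = v + v Z <> v]. The two spaces meet in zero, so their dimensions
   add up to at most [#|T|]. *)
Lemma skew_defect_bound (T : finType) (X Y Z : T -> T -> R)
    (B1 B2 J : {set T}) :
    (forall i k, i \notin B1 -> \sum_j X i j * Y j k = (i == k)%:R) ->
    (forall i k, i \notin B2 -> \sum_j Y i j * X j k = (i == k)%:R + Z i k) ->
    (forall v : T -> R, (forall i, i \notin J -> v i = 0) ->
       (forall k, \sum_i v i * Z i k = 0) -> forall i, v i = 0) ->
  (#|J| <= #|B1| + #|B2|)%N.
Proof.
move=> XY YX ZJ; rewrite leqNgt; apply/negP => Jlt.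
(* A dependency of the family [w] is a pair of vectors [u], [v] with [u X = - v]. *)
pose w (a : T + T) t := match a with inl i => X i t | inr j => (j == t)%:R end.
pose A : {set T + T} := [set a | match a with inl i => i \notin B1
  | inr j => (j \in J) && (j \notin B2) end].
have [|c [[a ca] cA cw]] := @skew_dependent _ _ A [set: T] w.
  have -> : #|A| = (#|~: B1| + #|J :\: B2|)%N.
    rewrite -(card_imset (~: B1) (@inl_inj T T)).
    rewrite -(card_imset (J :\: B2) (@inr_inj T T)).
    rewrite -cardsUI.
    have -> : (inl @: (~: B1)) :&: (inr @: (J :\: B2)) = set0 :> {set T + T}.
      apply/setP => x; rewrite !inE; apply/negP.
      by move=> /andP [/imsetP [i _ ->] /imsetP [j _]].
    rewrite cards0 addn0; apply: eq_card => -[i|j]; rewrite !inE.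
      rewrite (mem_imset _ _ (@inl_inj T T)) inE; case: imsetP => [[]//|_].
      by rewrite orbF.
    rewrite (mem_imset _ _ (@inr_inj T T)) inE; case: imsetP => [[]//|_] /=.
    by rewrite andbC.
  have := cardsC B1; have := cardsID B2 J.
  have := subset_leq_card (subsetIr J B2).
  rewrite cardsT; lia.
pose u i := c (inl i); pose v j := c (inr j).
have uB i : i \in B1 -> u i = 0 by move=> iB; apply: cA; rewrite inE iB.
have vJ j : j \notin J -> v j = 0.
  by move=> jJ; apply: cA; rewrite inE (negPf jJ).
have vB j : j \in B2 -> v j = 0 by move=> jB; apply: cA; rewrite inE jB andbF.
have uv t : \sum_i u i * X i t = - v t.
  have := cw t (in_setT _); rewrite big_sumType /= => /eqP.
  rewrite addr_eq0 => /eqP ->; congr (- _).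
  rewrite (bigD1 t) //= eqxx mulr1 big1 ?addr0 // => j /negPf ->.
  by rewrite mulr0.
have uXY k : \sum_j (\sum_i u i * X i j) * Y j k = u k.
  under eq_bigr do rewrite mulr_suml.
  rewrite exchange_big /= (bigD1 k) //= [X in _ + X]big1 ?addr0 => [|i ik].
    under eq_bigr do rewrite -mulrA.
    rewrite -mulr_sumr.
    have [kB|kB] := boolP (k \in B1); first by rewrite uB ?mul0r.
    by rewrite XY // eqxx mulr1.
  under eq_bigr do rewrite -mulrA.
  rewrite -mulr_sumr.
  have [iB|iB] := boolP (i \in B1); first by rewrite uB ?mul0r.
  by rewrite XY // (negPf ik) mulr0.
have vY k : \sum_j v j * Y j k = - u k.
  rewrite -[in RHS]uXY -sumrN; apply: eq_bigr => j _.
  by rewrite uv mulNr opprK.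
have vYX k : \sum_i v i * (\sum_j Y i j * X j k) = v k.
  under eq_bigr do rewrite mulr_sumr.
  rewrite exchange_big /= -[RHS]opprK -uv -sumrN; apply: eq_bigr => j _.
  by rewrite -mulNr -vY mulr_suml; apply: eq_bigr => i _; rewrite mulrA.
have v0 : forall i, v i = 0.
  apply: ZJ => // k; have := vYX k.
  rewrite (eq_bigr (fun i => v i * (i == k)%:R + v i * Z i k)) => [|i _]; last first.
    have [iB|iB] := boolP (i \in B2); first by rewrite vB // !mul0r addr0.
    by rewrite YX // mulrDr.
  rewrite big_split /= (bigD1 k) //= eqxx mulr1 big1 ?addr0 => [|i /negPf ->].
    by move=> E; apply: (addrI (v k)); rewrite E addr0.
  by rewrite mulr0.
case: a ca => [i|j]; last by rewrite -[c _]/(v j) v0 eqxx.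
rewrite -[c _]/(u i) -[u i]opprK -vY big1 ?oppr0 ?eqxx // => j _.
by rewrite v0 mul0r.
Qed.

End SkewField.

Section LocalRepresentation.
Variables (R : pzRingType) (G : groupType) (n : nat) (s : G -> 'S_n).
Local Notation RG := (grpring R G).

(** The entry at [(x, y)] of the linear extension of [s] to the group ring, with
   group elements acting on row vectors by [e_x |-> e_(s g x)]. *)
Definition gr_act (a : RG) (x y : 'I_n) : R :=
  gr_lift (fun g r => r *+ (s g x == y)) a.

Let FD x y (g : G) (a b : R) :
  (a + b) *+ (s g x == y) = a *+ (s g x == y) + b *+ (s g x == y).
Proof. exact: mulrnDl. Qed.

Lemma gr_actD (a b : RG) x y : gr_act (a + b) x y = gr_act a x y + gr_act b x y.
Proof. exact: (gr_liftD (FD x y)). Qed.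

Lemma gr_act0 x y : gr_act 0 x y = 0.
Proof. by apply: (addrI (gr_act 0 x y)); rewrite -gr_actD !addr0. Qed.

Lemma gr_actU g a x y : gr_act << a *g g >> x y = a *+ (s g x == y).
Proof. exact: (gr_liftU (FD x y)). Qed.

Lemma gr_act_sum (I : Type) (r : seq I) (F : I -> RG) x y :
  gr_act (\sum_(i <- r) F i) x y = \sum_(i <- r) gr_act (F i) x y.
Proof.
apply: (big_morph (fun a => gr_act a x y)) => [a b|]; first exact: gr_actD.
exact: gr_act0.
Qed.

(** Only the behaviour of [s] at the point [x] matters for row [x] of a product, so
   an approximate homomorphism yields the correct row at each of its good points. *)
Lemma gr_actM (a b : RG) x z :
  (forall g h, g \in msupp a -> h \in msupp b -> s (g * h)%g x = s h (s g x)) ->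
  \sum_y gr_act a x y * gr_act b y z = gr_act (a * b) x z.
Proof.
move=> loc; rewrite gr_mulE gr_act_sum.
under eq_bigr do rewrite /gr_act /gr_lift mulr_suml.
rewrite exchange_big /=; apply: eq_big_seq => g ga.
rewrite gr_act_sum (bigD1 (s g x)) //= eqxx mulr1n.
rewrite [X in _ + X]big1 => [|y]; last first.
  by rewrite eq_sym => /negPf ->; rewrite mul0r.
rewrite addr0 mulr_sumr; apply: eq_big_seq => h hb.
by rewrite gr_actU loc // mulrnAr.
Qed.

(** A block matrix with rows and columns indexed by pairs, which avoids flattening
   the indices into an ordinal. *)
Definition mx_act m (A : 'M[RG]_m) (t u : 'I_m * 'I_n) : R :=
  gr_act (A t.1 u.1) t.2 u.2.

Lemma mx_actM m (A B : 'M[RG]_m) (t u : 'I_m * 'I_n) :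
  (forall j g h, g \in msupp (A t.1 j) -> h \in msupp (B j u.1) ->
     s (g * h)%g t.2 = s h (s g t.2)) ->
  \sum_v mx_act A t v * mx_act B v u = mx_act (A *m B) t u.
Proof.
move=> loc; rewrite /mx_act mxE gr_act_sum.
rewrite -(pair_big predT predT
  (fun j y => gr_act (A t.1 j) t.2 y * gr_act (B j u.1) y u.2)) /=.
by apply: eq_bigr => j _; apply: gr_actM => g h; exact: loc.
Qed.

Hypothesis s1 : s 1%g = 1%g.

Lemma mx_act1 m (t u : 'I_m * 'I_n) : mx_act 1%:M t u = (t == u)%:R.
Proof.
case: t u => [i x] [j y]; rewrite /mx_act mxE /= xpair_eqE.
have [_|_] := eqVneq i j; last by rewrite mulr0n gr_act0.
by rewrite mulr1n gr_1E gr_actU s1 perm1 mulrb.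
Qed.

End LocalRepresentation.

(** Points [x] whose sets of images [f g x], [g \in F], are pairwise disjoint. In a
   maximal choice [J], the images of any point of [A] meet those of some point of
   [J], so every point of [A] has the form [(f h)^-1 (f g x)] with [x \in J]. *)
Lemma separated_subset (X K : finType) (A : {set X}) (F : {set K})
    (f : K -> {perm X}) :
  F != set0 ->
  exists2 J : {set X}, J \subset A /\
     {in J &, forall x y, x != y -> {in F &, forall g h, f g x != f h y}}
   & (#|A| <= #|J| * (#|F| * #|F|))%N.
Proof.
move=> /set0Pn [g0 g0F].
pose sep (J : {set X}) := (J \subset A) && [forall x in J, forall y in J,
  (x != y) ==> [forall g in F, forall h in F, f g x != f h y]].
have sepP (J : {set X}) : reflect (J \subset A /\
    {in J &, forall x y, x != y -> {in F &, forall g h, f g x != f h y}}) (sep J).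
  apply: (iffP andP) => -[JA sJ]; split=> //.
    move=> x y xJ yJ xy g h gF hF.
    move/forall_inP: sJ => /(_ x xJ) /forall_inP /(_ y yJ) /implyP /(_ xy).
    by move=> /forall_inP /(_ g gF) /forall_inP /(_ h hF).
  apply/forall_inP => x xJ; apply/forall_inP => y yJ; apply/implyP => xy.
  by apply/forall_inP => g gF; apply/forall_inP => h hF; exact: sJ.
have sep0 : sep set0.
  by apply/sepP; split; [exact: sub0set|move=> x y; rewrite inE].
have [J /maxsetP [sJ Jmax] _] := maxset_exists sep0.
exists J; first exact/sepP.
pose W := [set ((f p.2.2)^-1 (f p.2.1 p.1))%g | p in setX J (setX F F)].
apply: leq_trans (_ : #|W| <= _)%N; last first.
  by apply: leq_trans (leq_imset_card _ _) _; rewrite !cardsX.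
apply/subset_leq_card/subsetP => y yA; apply: contraT => yW.
have [JA sepJ] := sepP _ sJ.
have far x g h : x \in J -> g \in F -> h \in F -> f g x != f h y.
  move=> xJ gF hF; apply: contraNneq yW => E; apply/imsetP.
  by exists (x, (g, h)); rewrite ?inE ?xJ ?gF //= E permK.
have yJ : y \notin J.
  by apply/negP => yJ; have := far y g0 g0 yJ g0F g0F; rewrite eqxx.
have : sep (y |: J).
  apply/sepP; split; first by rewrite subUset sub1set yA.
  move=> x z /setU1P [->|xJ] /setU1P [->|zJ] xz g h gF hF.
  - by rewrite eqxx in xz.
  - by rewrite eq_sym far.
  - by rewrite far.
  - exact: sepJ.
by move=> /Jmax /(_ (subsetUr _ _)) /setP /(_ y); rewrite setU11 (negPf yJ).
Qed.

Lemma card_has_bound (X : finType) (P : eqType) (D : P -> pred X) (ps : seq P)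
    (c N : nat) :
  (forall p, p \in ps -> (c * #|[set x | D p x]| <= N)%N) ->
  (c * #|[set x | has (fun p => D p x) ps]| <= size ps * N)%N.
Proof.
elim: ps => [|p ps IH] H /=.
  by rewrite (eq_card0 (A := [set x | false])) ?muln0 // => x; rewrite inE.
have -> : [set x | D p x || has (fun q => D q x) ps] =
    [set x | D p x] :|: [set x | has (fun q => D q x) ps].
  by apply/setP => x; rewrite !inE.
rewrite mulSn; apply: leq_trans (_ : c * (#|[set x | D p x]| +
   #|[set x | has (fun q => D q x) ps]|) <= _)%N.
  by rewrite leq_mul2l -cardsUI leq_addr orbT.
rewrite mulnDr leq_add ?H ?mem_head // IH // => q qs.
by apply: H; rewrite in_cons qs orbT.
Qed.

Lemma hamming_le n (s t : 'S_n) K : (0 < n)%N -> hamming s t <= (K.+1%:R)^-1 ->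
  (K.+1 * #|[set i | s i != t i]| <= n)%N.
Proof.
move=> n0; rewrite /hamming ler_pdivrMr ?ltr0n // mulrC ler_pdivlMr ?ltr0n //.
rewrite -natrM ler_nat mulnC; congr (_ * _ <= _)%N.
by apply: eq_card => i; rewrite !inE.
Qed.

Lemma hamming_ge n (s t : 'S_n) K :
  (0 < n)%N -> 1 - (K.+1%:R)^-1 <= hamming s t ->
  (K.+1 * #|[set i | s i == t i]| <= n)%N.
Proof.
move=> n0; rewrite lerBlDr -lerBlDl => H.
have E : 1 - hamming s t = #|[set i | s i == t i]|%:R / n%:R.
  apply: (mulIf (x := n%:R)); first by rewrite pnatr_eq0 -lt0n.
  rewrite mulrBl mul1r !divfK ?pnatr_eq0 -?lt0n //.
  apply/eqP; rewrite subr_eq -natrD eqr_nat -[X in X == _](card_ord n).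
  rewrite -(cardsC [set i | s i == t i]); apply/eqP; congr (_ + _)%N.
  by apply: eq_card => i; rewrite !inE.
move: H; rewrite E ler_pdivrMr ?ltr0n // mulrC ler_pdivlMr ?ltr0n //.
by rewrite -natrM ler_nat mulnC.
Qed.

(** The metric definition of soficity in combinatorial form: on a finite part [E] of
   the group, and outside a set [B] of points of proportion at most [1 / c], the
   maps [s g] compose exactly and take distinct values for distinct [g]. *)
Lemma sofic_model (G : groupType) (E : seq G) (c : nat) : sofic G ->
  exists (n : nat) (s : G -> 'S_n) (B : {set 'I_n}),
  [/\ (0 < n)%N, s 1%g = 1%g, (c * #|B| <= n)%N,
      forall x g h, x \notin B -> g \in E -> h \in E ->
        s (g * h)%g x = s h (s g x)
    & forall x g h, x \notin B -> g \in E -> h \in E -> g != h ->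
        s g x != s h x].
Proof.
move=> sG; pose ps := [seq (g, h) | g <- E, h <- E].
(* Each pair in [ps] spoils at most [2 n / K.+1] points. *)
pose K := (c * (size ps).*2)%N.
have [|n [n0 [s [sM s1 sI]]]] := sG E (K.+1%:R)^-1.
  by rewrite invr_gt0 ltr0n.
pose D (p : G * G) x := (s (p.1 * p.2)%g x != s p.2 (s p.1 x))
  || ((p.1 != p.2) && (s p.1 x == s p.2 x)).
exists n, s, [set x | has (fun p => D p x) ps].
have DP x g h : x \notin [set x | has (fun p => D p x) ps] ->
    g \in E -> h \in E -> ~~ D (g, h) x.
  move=> + gE hE; rewrite inE; apply: contraNN => Dx; apply/hasP.
  by exists (g, h) => //; apply: allpairs_f.
split=> // [|x g h xB gE hE|x g h xB gE hE gh].
- have : (K.+1 * #|[set x | has (fun p => D p x) ps]| <= size ps * n.*2)%N.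
    apply: card_has_bound => _ /allpairsP [[g h] /= [gE hE ->]].
    have := hamming_le n0 (sM g h gE hE).
    set D1 := [set i | _] => D1n.
    pose D2 := [set x | (g != h) && (s g x == s h x)].
    have D2n : (K.+1 * #|D2| <= n)%N.
      have [gh|gh] := eqVneq g h.
        by rewrite (eq_card0 (A := D2)) ?muln0 // => x; rewrite inE gh eqxx.
      apply: leq_trans (hamming_ge n0 (sI g h gE hE gh)).
      rewrite leq_mul2l subset_leq_card ?orbT //.
      by apply/subsetP => x; rewrite !inE => /andP [].
    have -> : [set x | D (g, h) x] = D1 :|: D2.
      by apply/setP => x; rewrite !inE permM.
    rewrite -addnn; apply: leq_trans (leq_add D1n D2n).
    by rewrite -mulnDr leq_mul2l -cardsUI leq_addr orbT.
  rewrite /K -!mul2n; case: (size ps) => [|l]; nia.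
- by have := DP x g h xB gE hE; rewrite /D /= negb_or negbK => /andP [/eqP].
- by have := DP x g h xB gE hE; rewrite /D /= negb_or gh => /andP [].
Qed.

(** Outside the bad points, [A], [B] and [Z = B A - 1] act as [skew_defect_bound]
   requires. If the entry [(i0, j0)] of [Z] is nonzero, the rows of the block
   [(i0, j0)] at separated good points have disjoint nonempty supports, hence are
   independent. With [f] the square of the size of the support of that entry and
   [b] the number of bad points, this gives [n - b <= 2 m b f], which is excluded
   once [b] is a small enough fraction of [n]. *)
Theorem sofic_stably_finite (R : pzRingType) (G : groupType) :
  is_skew_field R -> sofic G -> stably_finite (grpring R G).
Proof.
move=> skR sG m _ A B AB; apply/eqP; rewrite -subr_eq0; apply: contraT => nz.
pose Z : 'M_m := B * A - 1.
have [i0 [j0 z0]] : exists i j, Z i j != 0.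
  have /existsP [i /existsP [j ij]] : [exists i, exists j, Z i j != 0]; last first.
    by exists i, j.
  apply: contraNT nz => /existsPn Z0; apply/eqP/matrixP => i j; rewrite [RHS]mxE.
  by have /existsPn /(_ j) /negPn /eqP := Z0 i.
pose supp (C : 'M[grpring R G]_m) : seq G :=
  flatten [seq (msupp (C p.1 p.2) : seq G) | p : 'I_m * 'I_m].
have suppP (C : 'M[grpring R G]_m) i j g : g \in msupp (C i j) -> g \in supp C.
  by move=> gC; apply/flatten_imageP; exists (i, j).
pose E := supp A ++ supp B ++ supp Z.
have EA g : g \in supp A -> g \in E by rewrite !mem_cat => ->; rewrite ?orbT.
have EB g : g \in supp B -> g \in E by rewrite !mem_cat => ->; rewrite ?orbT.
have EZ g : g \in supp Z -> g \in E by rewrite !mem_cat => ->; rewrite ?orbT.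
pose F : finType := msupp (Z i0 j0).
have [g0 g0Z] : exists g, g \in msupp (Z i0 j0).
  apply/fset0Pn; apply: contraNneq z0 => E0; apply/eqP/malgP => g.
  by rewrite mcoeff0 mcoeff_outdom // E0 inE.
pose c := (1 + 2 * m * (#|F| * #|F|)).+1%N.
have [n [s [Bad [n0 s1 cB sM sI]]]] := sofic_model E c sG.
pose k0 : F := [` g0Z]%fset.
have [|J [JB Jsep] Jbig] :=
  @separated_subset _ F (~: Bad) setT (fun k => s (val k)).
  by apply/set0Pn; exists k0; rewrite inE.
rewrite cardsT in Jbig.
pose BB := setX [set: 'I_m] Bad; pose JJ := setX [set i0] J.
have : (#|JJ| <= #|BB| + #|BB|)%N.
  apply: (@skew_defect_bound R skR _ (mx_act s A) (mx_act s B) (mx_act s Z)).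
- move=> t u; rewrite !inE /= => tB; rewrite mx_actM => [|j g h gA hB].
    by rewrite -(mx_act1 R s1); congr (mx_act s _ t u).
  by apply: sM; rewrite // ?(EA _ (suppP _ _ _ _ gA)) ?(EB _ (suppP _ _ _ _ hB)).
- move=> t u; rewrite !inE /= => tB; rewrite mx_actM => [|j g h gA hB].
    have -> : B *m A = 1%:M + Z by rewrite /Z addrC subrK.
    by rewrite -(mx_act1 R s1) /mx_act mxE gr_actD.
  by apply: sM; rewrite // ?(EB _ (suppP _ _ _ _ gA)) ?(EA _ (suppP _ _ _ _ hB)).
- move=> v vJ vZ [i x]; have [|] := boolP ((i, x) \in JJ); last exact: vJ.
  rewrite !inE /= => /andP [/eqP -> xJ].
  (* Among the rows in [J], only that of [x] has an entry in column [s g0 x]. *)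
  have := vZ (j0, s g0 x); rewrite (bigD1 (i0, x)) //= big1 ?addr0 => [|[j y] jy].
    rewrite /mx_act /= /gr_act /gr_lift.
    have xB : x \notin Bad by have /subsetP /(_ x xJ) := JB; rewrite inE.
    rewrite (big_fsetD1 g0) //= eqxx mulr1n big_seq_cond big1 ?addr0.
      by apply: skew_mulf_eq0; rewrite // mcoeff_neq0.
    move=> g; rewrite andbT !inE => /andP [gg0 gZ].
    have /negPf -> := sI x g g0 xB (EZ _ (suppP _ _ _ _ gZ))
      (EZ _ (suppP _ _ _ _ g0Z)) gg0.
    by rewrite mulr0n.
  have [|] := boolP ((j, y) \in JJ); last by move=> /vJ ->; rewrite mul0r.
  rewrite !inE /= => /andP [/eqP ji yJ]; rewrite ji in jy *.
  have yx : y != x by apply: contraNneq jy => ->.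
  rewrite /mx_act /= /gr_act /gr_lift big_seq big1 ?mulr0 // => g gZ.
  have /= /negPf -> :=
    Jsep y x yJ xJ yx [` gZ]%fset k0 (in_setT _) (in_setT _).
  by rewrite mulr0n.
rewrite !cardsX cardsT card_ord cards1 mul1n.
have := cardsC Bad; rewrite card_ord.
move: cB Jbig; rewrite /c.
move: (#|F| * #|F|)%N #|Bad| #|J| #|~: Bad| => f b j a.
move=> nb ajf ba jb.
have [b0|b0] := posnP b.
  by rewrite b0 !muln0 leqn0 in jb; rewrite (eqP jb) in ajf; lia.
have jfb : (j * f <= (m * b + m * b) * f)%N by rewrite leq_mul2r jb orbT.
have cbE : ((1 + 2 * m * f).+1 * b = 2 * b + (m * b + m * b) * f)%N by ring.
by move: nb jfb ajf; rewrite cbE; move: (j * f)%N ((_ + _) * f)%N => p q; lia.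
Qed.

(** * Specialization to a closed field *)

Section Specialization.
Variables (K : fieldType) (C : closedFieldType).

(** [P] is to be thought of as a polynomial ring over [int], and [iota] as the
   evaluation at some elements of [K]: the relations that these elements satisfy
   over [int] also hold for some elements of [C] that avoid a given hypersurface
   [d]. This form is stable under adjoining one element at a time. *)
Definition specializable (P : idomainType) (iota : {rmorphism P -> K}) : Prop :=
  forall d : P, iota d != 0 -> exists phi : {rmorphism P -> C},
    phi d != 0 /\ forall a, iota a = 0 -> phi a = 0.

Section Step.
Variables (P : idomainType) (iota : {rmorphism P -> K}) (x : K).
Hypothesis spec : specializable iota.

Definition ext_eval : {rmorphism {poly P} -> K} :=
  horner_eval x \o map_poly iota.

Lemma ext_evalE p : ext_eval p = (map_poly iota p).[x].
Proof. by []. Qed.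

Lemma drop_lead_coef (p : {poly P}) : p != 0 -> iota (lead_coef p) = 0 ->
  exists2 q : {poly P}, (size q < size p)%N & map_poly iota q = map_poly iota p.
Proof.
move=> p0 lp; exists (take_poly (size p).-1 p).
  apply: leq_ltn_trans (size_take_poly _ _) _.
  by rewrite prednK // lt0n size_poly_eq0.
apply/polyP => i; rewrite !coef_map coef_take_poly; case: ltnP => // pi.
rewrite raddf0; have [->|ip] := eqVneq i (size p).-1; first exact: esym lp.
rewrite nth_default ?raddf0 //; move: pi; rewrite leq_eqVlt eq_sym (negPf ip) /=.
by case: (size p).
Qed.

(** A specialization of [P] that keeps a nonzero coefficient of [d] may send [x] to
   any non-root of the specialized polynomial. *)
Lemma specializable_transcendental :
  (forall p, ext_eval p = 0 -> map_poly iota p = 0) -> specializable ext_eval.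
Proof.
move=> trx d d0.
have : map_poly iota d != 0.
  by apply: contra_neq d0; rewrite ext_evalE => ->; rewrite horner0.
rewrite -lead_coef_eq0 lead_coefE coef_map => /spec [phi [phid kphi]].
have /closed_nonrootP [alpha da] : map_poly phi d != 0.
  apply: contraNneq phid => /polyP /(_ (size (map_poly iota d)).-1).
  by rewrite coef_map coef0 => ->.
exists (horner_eval alpha \o map_poly phi); split=> [//|p /trx p0].
rewrite /= /horner_eval; suff -> : map_poly phi p = 0 by rewrite horner0.
apply/polyP => i; rewrite coef_map coef0; apply: kphi.
by rewrite -coef_map p0 coef0.
Qed.

(** Let [m] be a relation of minimal degree for [x]. A specialization [phi] of [P]
   that keeps the leading coefficient of [m] extends by sending [x] to a root [alpha] of
   the specialized [m]: by pseudo-division and minimality, every relation is a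
   multiple of [m], up to a power of that coefficient and a remainder that [iota]
   kills. To keep [d] as well, it suffices to keep a nonzero multiple [b] of [d] that
   comes from [P]; the Euclidean algorithm between [m] and [d] finds one. *)
Lemma specializable_algebraic :
  (exists2 p, map_poly iota p != 0 & ext_eval p = 0) -> specializable ext_eval.
Proof.
move=> [p p0 px].
pose vanish n := `[< exists p : {poly P},
  [/\ size p = n, map_poly iota p != 0 & ext_eval p = 0] >].
have exv : exists n, vanish n by exists (size p); apply/asboolP; exists p.
case: (ex_minnP exv) => n /asboolP [m [mn m0 mx]] nmin.
have mmin (q : {poly P}) :
    ext_eval q = 0 -> (size q < size m)%N -> map_poly iota q = 0.
  move=> qx; apply: contraTeq => q0; rewrite -leqNgt mn; apply: nmin.
  by apply/asboolP; exists q.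
have mN0 : m != 0 by apply: contraNneq m0 => ->; rewrite rmorph0.
have lm : iota (lead_coef m) != 0.
  apply: contraNneq m0 => /(drop_lead_coef mN0) [q qm qE].
  by rewrite -qE mmin // ext_evalE qE.
have evZ c (q : {poly P}) : ext_eval (c *: q) = iota c * ext_eval q.
  by rewrite !ext_evalE map_polyZ hornerZ.
have denom (d : {poly P}) : ext_eval d != 0 ->
    exists q b, iota b != 0 /\ ext_eval q * ext_eval d = iota b.
  have [k] := ubnP (size d); elim: k d => // k IHk d dk d0.
  have dN0 : d != 0 by apply: contraNneq d0 => ->; rewrite rmorph0.
  have [dm|md] := ltnP (size d) (size m); last first.
    have := Pdiv.Idomain.divp_eq d m; set l := _ ^+ _; move: (d %/ m) => s dE.
    have rE : iota l * ext_eval d = ext_eval (d %% m).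
      by rewrite -evZ dE rmorphD rmorphM mx mulr0 add0r.
    have [||q [b [b0 qb]]] := IHk (d %% m).
    - rewrite -ltnS; apply: leq_trans dk.
      by rewrite ltnS (leq_trans _ md) ?ltn_modp.
    - by rewrite -rE mulf_neq0 // rmorphXn expf_neq0.
    by exists (l *: q), b; rewrite evZ mulrAC rE mulrC.
  have [d1|d1] := leqP (size d) 1.

    have dC := size1_polyC d1; exists 1, d`_0; rewrite rmorph1 mul1r.
    have dE : ext_eval d = iota d`_0.
      by rewrite dC ext_evalE map_polyC hornerC coefC.
    by rewrite -dE.
  have [ld|ld] := eqVneq (iota (lead_coef d)) 0.
    have [d' d'd d'E] := drop_lead_coef dN0 ld.
    have dd' : ext_eval d = ext_eval d' by rewrite !ext_evalE d'E.
    rewrite dd' in d0 *; apply: IHk => //; exact: leq_trans d'd dk.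
  have := Pdiv.Idomain.divp_eq m d; set l := _ ^+ _.
  have l0 : iota l != 0 by rewrite rmorphXn expf_neq0.
  have lN0 : l != 0 by apply: contraNneq l0 => ->; rewrite rmorph0.
  have rd : (size (m %% d)%R < size d)%N by rewrite ltn_modp.
  move: (m %/ d) (m %% d) rd => s r rd mE.
  have rE : ext_eval r = - ext_eval s * ext_eval d.
    have := congr1 ext_eval mE; rewrite evZ mx mulr0 rmorphD rmorphM mulNr.
    by move=> /esym /eqP; rewrite addrC addr_eq0 => /eqP.
  have [r0|r0] := eqVneq (ext_eval r) 0; last first.
    have [|q [b [b0 qb]]] := IHk r _ r0; first exact: leq_trans rd dk.
    by exists (q * - s), b; rewrite rmorphM rmorphN -mulrA -rE.
  (* If the remainder [r] is a relation, so is the quotient [s]; as [d] is not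
     constant, both are shorter than [m], so [iota] kills them, and then also [m]. *)
  have s0 : ext_eval s = 0.
    move/eqP: rE; rewrite r0 eq_sym mulNr oppr_eq0 mulf_eq0.
    by rewrite (negPf d0) orbF => /eqP.
  have sN0 : s != 0.
    apply: contraTneq dm => s00; rewrite -leqNgt; apply: ltnW.
    apply: leq_ltn_trans rd.
    by rewrite -(size_scale m lN0) mE s00 mul0r add0r.
  have sm : (size s < size m)%N.
    have s1 : (0 < size s)%N by rewrite size_poly_gt0.
    rewrite -(size_scale m lN0) mE size_polyDl size_mul //.
      by move: d1 s1; clear; move: (size d) (size s) => a b; lia.
    by move: rd s1; clear; move: (size r) (size d) (size s) => a b c; lia.
  have := congr1 (map_poly iota) mE; rewrite map_polyZ rmorphD rmorphM /=.
  rewrite (mmin s) // (mmin r) ?mul0r ?addr0 //; last exact: ltn_trans rd dm.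
  by move/eqP; rewrite scaler_eq0 (negPf l0) (negPf m0).
move=> d /denom [q [b [b0 qb]]].
have [|phi [phiab kphi]] := @spec (lead_coef m * b).
  by rewrite rmorphM mulf_neq0.
have [philm phib] : phi (lead_coef m) != 0 /\ phi b != 0.
  by apply/andP; rewrite -negb_or -mulf_eq0 -rmorphM.
have /closed_rootP [alpha /rootP m_alpha] : size (map_poly phi m) != 1%N.
  rewrite size_map_poly_id0 //; apply: contra_eqN mx => /eqP m1.
  rewrite (size1_polyC (eq_leq m1)) ext_evalE map_polyC hornerC.
  by move: lm; rewrite lead_coefE m1.
pose psi : {rmorphism {poly P} -> C} := horner_eval alpha \o map_poly phi.
have psiE q' : psi q' = (map_poly phi q').[alpha] by [].
have kpsi f : ext_eval f = 0 -> psi f = 0.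
  move=> fx; have := Pdiv.Idomain.divp_eq f m; set l := _ ^+ _ => fE.
  have rm : (size (f %% m)%R < size m)%N by rewrite ltn_modp.
  have r0 : ext_eval (f %% m) = 0.
    have := congr1 ext_eval fE; rewrite evZ fx mulr0 rmorphD rmorphM.
    by rewrite [ext_eval m]mx mulr0 add0r => <-.
  have psir : psi (f %% m) = 0.
    rewrite psiE; suff -> : map_poly phi (f %% m) = 0 by rewrite horner0.
    apply/polyP => i; rewrite coef_map coef0; apply: kphi.
    by rewrite -coef_map mmin ?coef0.
  have : psi (l *: f) = 0.
    by rewrite fE rmorphD psir addr0 rmorphM psiE [psi m]psiE m_alpha mulr0.
  rewrite psiE map_polyZ hornerZ => /eqP.
  by rewrite mulf_eq0 rmorphXn expf_eq0 (negPf philm) andbF => /eqP.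
exists psi; split=> //; apply: contraNneq phib => psid.
have /kpsi : ext_eval (q * d - b%:P) = 0.
  rewrite rmorphB rmorphM qb [ext_eval b%:P]ext_evalE map_polyC hornerC.
  by rewrite subrr.
rewrite rmorphB rmorphM psid mulr0 sub0r [psi _]psiE map_polyC hornerC => /eqP.
by rewrite oppr_eq0.
Qed.

Lemma specializable_ext : specializable ext_eval.
Proof.
have [alg|tr] := pselect (exists2 p, map_poly iota p != 0 & ext_eval p = 0).
  exact: specializable_algebraic.
apply: specializable_transcendental => p px; apply/eqP/negPn/negP => p0.
by apply: tr; exists p.
Qed.

End Step.

Lemma specializable_seq (s : seq K) :
    char_zero K -> char_zero C ->
  exists (P : idomainType) (iota : {rmorphism P -> K}),
    specializable iota /\ forall x, x \in s -> exists a, iota a = x.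
Proof.
move=> K0 C0; elim: s => [|x s [P [iota [spec sP]]]].
  have intr0 (F : fieldType) (z : int) :
      char_zero F -> (z%:~R == 0 :> F) = (z == 0).
    move=> F0; case: (intP z) => [|n|n]; first by rewrite mulr0z !eqxx.
      by rewrite -pmulrn (negPf (F0 _ _)).
    by rewrite mulrNz !oppr_eq0 -pmulrn (negPf (F0 _ _)).
  exists int, intr; split=> // d d0; exists intr; split=> [|a /eqP].
    by rewrite intr0 // -(intr0 K).
  by rewrite intr0 // => /eqP ->.
exists {poly P}, (ext_eval iota x); split; first exact: specializable_ext.
move=> y; rewrite inE => /predU1P [->|/sP [a <-]].
  by exists 'X; rewrite ext_evalE map_polyX hornerX.
by exists a%:P; rewrite ext_evalE map_polyC hornerC.
Qed.

End Specialization.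

(** * Idempotents of trace zero *)

Section Kaplansky.
Variables (C : archiClosedFieldType) (G : groupType).
Local Notation CG := (grpring C G).
Implicit Types x y z e : CG.

(** The conjugate-linear anti-involution with [g |-> g^-1], which makes
   [tr (x (star x))] the sum of the squared moduli of the coefficients. *)
Definition star x : CG :=
  gr_lift (fun g a => << a^* *g g^-1%g >> : CG) x.

Let starF (g : G) (a b : C) :
  << (a + b)^* *g g^-1%g >> = << a^* *g g^-1%g >> + << b^* *g g^-1%g >> :> CG.
Proof. by rewrite rmorphD monalgUD. Qed.

Lemma starD x y : star (x + y) = star x + star y.
Proof. exact: gr_liftD starF x y. Qed.

Lemma starU g a : star << a *g g >> = << a^* *g g^-1%g >>.
Proof. exact: gr_liftU starF g a. Qed.

Lemma starK : involutive star.
Proof.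
apply: (eq_additive_on_monomials (f1 := fun x => star (star x)) (f2 := id))
  => // [x y|g a].
  by rewrite !starD.
by rewrite !starU conjCK invgK.
Qed.

Lemma starM x y : star (x * y) = star y * star x.
Proof.
move: x; apply: eq_additive_on_monomials => [u v|u v|g a].
- by rewrite mulrDl starD.
- by rewrite starD mulrDr.
move: y; apply: eq_additive_on_monomials => [u v|u v|h b].
- by rewrite mulrDr starD.
- by rewrite starD mulrDl.
by rewrite gr_mulUU !starU gr_mulUU rmorphM mulrC invgM.
Qed.

Lemma star1 : star 1 = 1.
Proof. by rewrite gr_1E starU conjC1 invg1. Qed.

Definition tr x : C := x@_1%g.

Lemma trD x y : tr (x + y) = tr x + tr y. Proof. exact: mcoeffD. Qed.
Lemma trN x : tr (- x) = - tr x. Proof. exact: mcoeffN. Qed.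
Lemma trC x y : tr (x * y) = tr (y * x).
Proof. by apply: gr_trC => a b; exact: mulrC. Qed.

Lemma tr_star x : tr (star x) = (tr x)^*.
Proof.
apply: (eq_additive_on_monomials (f1 := fun x => tr (star x))
  (f2 := fun x => (tr x)^*)) x => [x y|x y|g a].
- by rewrite starD trD.
- by rewrite trD rmorphD.
by rewrite starU /tr !mcoeffU rmorphMn invg_eq1.
Qed.

(** Locked, because unification would otherwise compute in the group ring. *)
Definition dot x y : C := locked (tr (x * star y)).
Definition nrm x : C := dot x x.

Lemma dot_tr x y : dot x y = tr (x * star y).
Proof. by rewrite /dot -lock. Qed.

Lemma dotDl x y z : dot (x + y) z = dot x z + dot y z.
Proof. by rewrite !dot_tr mulrDl trD. Qed.
Lemma dotDr x y z : dot x (y + z) = dot x y + dot x z.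
Proof. by rewrite !dot_tr starD mulrDr trD. Qed.

Lemma dotC x y : dot y x = (dot x y)^*.
Proof. by rewrite !dot_tr -tr_star starM starK. Qed.

(** The adjoint of the right multiplication by [y] is that by [star y]. *)
Lemma dotMr x y z : dot (x * y) z = dot x (z * star y).
Proof. by rewrite !dot_tr starM starK mulrA. Qed.

Lemma dot1r x : dot x 1 = tr x.
Proof. by rewrite dot_tr star1 mulr1. Qed.

Lemma dotUl g a y : dot << a *g g >> y = a * (y@_g)^*.
Proof.
apply: (eq_additive_on_monomials (f1 := fun y => dot << a *g g >> y)
  (f2 := fun y => a * (y@_g)^*)) y => [u v|u v|h b].
- exact: dotDr.
- by rewrite mcoeffD rmorphD mulrDr.
rewrite dot_tr starU gr_mulUU /tr !mcoeffU rmorphMn mulrnAr.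
by rewrite divg_eq1 eq_sym.
Qed.

Lemma dotE x y : dot x y = \sum_(g <- msupp x) x@_g * (y@_g)^*.
Proof.
have FD (g : G) (a b : C) : (a + b) * (y@_g)^* = a * (y@_g)^* + b * (y@_g)^*.
  exact: mulrDl.
apply: (eq_additive_on_monomials (f1 := fun x => dot x y)
  (f2 := gr_lift (fun g a => a * (y@_g)^*))) x => [u v|u v|g a].
- exact: dotDl.
- exact: gr_liftD.
by rewrite gr_liftU // dotUl.
Qed.

Lemma nrm_ge0 x : 0 <= nrm x.
Proof. by rewrite /nrm dotE sumr_ge0 // => g _; exact: mul_conjC_ge0. Qed.

Lemma nrm_coef x g : `|x@_g| ^+ 2 <= nrm x.
Proof.
rewrite normCK /nrm dotE; have [gx|gx] := boolP (g \in msupp x); last first.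
  by rewrite mcoeff_outdom // mul0r sumr_ge0 // => h _; exact: mul_conjC_ge0.
by rewrite (big_fsetD1 g) //= lerDl sumr_ge0 // => h _; exact: mul_conjC_ge0.
Qed.

Lemma nrm_eq0 x : nrm x = 0 -> x = 0.
Proof.
move=> x0; apply/malgP => g; rewrite mcoeff0; apply/eqP.
have := nrm_coef x g; rewrite x0 => xg.
by rewrite -normr_eq0 -sqrf_eq0 eq_le xg exprn_ge0.
Qed.

Lemma nrmD x y : nrm (x + y) = nrm x + nrm y + (dot x y + dot y x).
Proof. rewrite /nrm dotDl (dotDr x) (dotDr y).
by move: (dot x x) (dot x y) (dot y x) (dot y y) => a b c d; ring. Qed.

Lemma starN x : star (- x) = - star x.
Proof.
have s0 : star 0 = 0 by apply: (addrI (star 0)); rewrite -starD !addr0.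
by apply/eqP; rewrite -addr_eq0 -starD addNr s0.
Qed.

Lemma nrmN x : nrm (- x) = nrm x.
Proof. by rewrite /nrm !dot_tr starN mulrNN. Qed.

Lemma nrmD_le x y : nrm (x + y) <= (nrm x + nrm y) *+ 2.
Proof.
rewrite -subr_ge0; have := nrm_ge0 (x - y).
have dN a b : dot a (- b) = - dot a b by rewrite !dot_tr starN mulrN trN.
have Nd a b : dot (- a) b = - dot a b by rewrite !dot_tr mulNr trN.
rewrite !nrmD nrmN dN Nd; move: (nrm x) (nrm y) (dot x y) (dot y x) => a b c d.
by congr (_ <= _); ring.
Qed.

Definition scal (c : C) : CG := << c *g 1%g >>.

Lemma tr_scal x c : tr (x * scal c) = c * tr x.
Proof.
apply: (eq_additive_on_monomials (f1 := fun x => tr (x * scal c))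
  (f2 := fun x => c * tr x)) x => [x y|x y|g a].
- by rewrite mulrDl trD.
- by rewrite trD mulrDr.
by rewrite gr_mulUU /tr !mcoeffU mulg1 mulrnAr mulrC.
Qed.

Lemma dot_scall x y c : dot (x * scal c) y = c * dot x y.
Proof. by rewrite !dot_tr -mulrA trC -mulrA trC tr_scal trC. Qed.

Lemma dot_scalr x y c : dot x (y * scal c) = c^* * dot x y.
Proof. by rewrite dotC dot_scall rmorphM /= [in RHS]dotC. Qed.

(** Right multiplication by a monomial scales the norm, and boundedness is inherited
   by sums. *)
Lemma nrm_mulr_bounded y :
  exists2 B : C, 1 <= B & forall x, nrm (x * y) <= B * nrm x.
Proof.
suff [B B0 yB] : exists2 B : C, 0 <= B & forall x, nrm (x * y) <= B * nrm x.
  exists (1 + B) => [|x]; first by rewrite lerDl.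
  by rewrite (le_trans (yB x)) // ler_wpM2r ?nrm_ge0 // lerDr.
rewrite (grpring_sum y); apply: (big_ind (fun y => exists2 B : C, 0 <= B &
  forall x, nrm (x * y) <= B * nrm x)) => [|u v [B B0 uB] [B' B'0 vB']|g _].
- by exists 0 => // x; rewrite mulr0 mul0r /nrm dot_tr mul0r /tr mcoeff0.
- exists ((B + B') *+ 2) => [|x]; first by rewrite mulrn_wge0 ?addr_ge0.
  rewrite mulrDr (le_trans (nrmD_le _ _)) // mulrnAl lerMn2r /= mulrDl.
  exact: lerD.
move: (y@_g) => c; exists (c * c^*) => [|x]; first exact: mul_conjC_ge0.
rewrite /nrm dotMr -mulrA starU gr_mulUU mulgV -/(scal _).
by rewrite dot_scalr rmorphM /= conjCK [c^* * c]mulrC.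
Qed.

Section ApproximateProjection.
Variables (e : CG) (delta : C).
Hypothesis delta_gt0 : 0 < delta.

(** The infimum of the distances to [1] is attained up to [delta]: otherwise a
   nonnegative number could be decreased by [delta] arbitrarily often. Unlike an
   orthogonal projection, this does not need completeness. *)
Lemma nearly_closest_exists : exists2 a, e * a = a
  & forall b, e * b = b -> nrm (a - 1) <= nrm (b - 1) + delta.
Proof.
apply: contrapT => no.
have step a : e * a = a ->
    exists2 b, e * b = b & nrm (b - 1) + delta <= nrm (a - 1).
  move=> ea; apply: contrapT => nob; apply: no; exists a => // b eb.
  rewrite real_leNgt ?ger0_real ?addr_ge0 ?nrm_ge0 ?(ltW delta_gt0) //.
  by apply/negP => /ltW ba; apply: nob; exists b.
have far k : exists2 a, e * a = a & nrm (a - 1) + delta *+ k <= 1.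
  elim: k => [|k [a ea ak]].
    exists 0; rewrite ?mulr0 // sub0r nrmN addr0 /nrm dot1r /tr.
    by rewrite gr_1E mcoeffUU.
  have [b eb ba] := step a ea; exists b => //; move: ba ak.
  move: (nrm (b - 1)) (nrm (a - 1)) => u v uv; apply: le_trans.
  by rewrite mulrS addrA lerD2r.
have [a _ ak] := far (Num.bound delta^-1).
have : 1 < delta *+ Num.bound delta^-1.
  rewrite -mulr_natr -ltr_pdivrMl // mulr1; apply: archi_boundP.
  by rewrite invr_ge0 ltW.
apply/negP; rewrite -real_leNgt ?ger0_real ?mulrn_wge0 ?(ltW delta_gt0) //.
by apply: le_trans ak; rewrite lerDr nrm_ge0.
Qed.

(** The usual variation of a minimizer [a] in a direction [c] of the ideal; it gains
   [|dot c (a - 1)|^2 / nrm c], which cannot exceed [delta]. *)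
Lemma nearly_closest_orthogonal a c M :
    (forall b, e * b = b -> nrm (a - 1) <= nrm (b - 1) + delta) ->
    e * a = a -> e * c = c -> nrm c <= M -> 0 < M ->
  `|dot c (a - 1)| ^+ 2 <= delta * M.
Proof.
move=> amin ea ec cM M0; set f := dot c (a - 1).
have M1 : 0 < M^-1 by rewrite invr_gt0.
(* The optimal step, with the norm of [c] replaced by its bound [M]. *)
pose t := - (M^-1 * f^*).
have tC : t^* = - (M^-1 * f).
  by rewrite /t rmorphN rmorphM /= conjCK (conj_Creal (ger0_real _)) // ltW.
have /amin : e * (a + c * scal t) = a + c * scal t.
  by rewrite mulrDr mulrA ea ec.
have -> : a + c * scal t - 1 = (a - 1) + c * scal t by exact: addrAC.
have -> : nrm (a - 1 + c * scal t) =
    nrm (a - 1) + (t * (t^* * nrm c) + (t^* * f^* + t * f)).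
  rewrite nrmD /nrm dot_scalr !dot_scall dot_scalr [dot (a - 1) c]dotC -/f.
  by move: (dot _ _) (dot c c) => u v; ring.
rewrite tC /t normCK {t tC}.
move: (nrm (a - 1)) (nrm c) cM (mul_conjC_ge0 f) => u v vM.
move: (f) (f^*) => {}f f' ff0.
have vM' : (M^-1 * M^-1 * (f * f')) * v <= (M^-1 * M^-1 * (f * f')) * M.
  exact: ler_wpM2l (mulr_ge0 (mulr_ge0 (ltW M1) (ltW M1)) ff0) _ _ vM.
have vM'E : (M^-1 * M^-1 * (f * f')) * M = M^-1 * (f * f').
  by rewrite mulrC !mulrA divff ?mul1r // gt_eqF.
rewrite -subr_ge0 => H.
have {H}: 0 <= delta - M^-1 * (f * f').
  apply: le_trans H _; rewrite -subr_ge0.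
  move: vM'; rewrite vM'E -subr_ge0; congr (_ <= _); ring.
by rewrite subr_ge0 ler_pdivrMl // [M * _]mulrC.
Qed.
End ApproximateProjection.

(** Let [a] be a near-projection of [1] on the right ideal [e CG]. An orthogonal
   projection would be self-adjoint with the same image as [e], giving [a e = e],
   [tr a = nrm a] and [tr a = tr (e a) = tr (a e) = tr e]; so [tr e = 0] would give
   [a = 0] and [e = 0]. Here these equalities hold up to powers of [rho], where
   [delta = rho ^+ 4] leaves room for taking two square roots. *)
Lemma idempotent_nrm_small e : e * e = e -> tr e = 0 ->
  exists2 K : C, 0 <= K & forall rho : C, 0 < rho <= 1 -> nrm e <= K * rho.
Proof.
move=> ee te; have [B1 B1_ge1 eB1] := nrm_mulr_bounded e.
have [B2 B2_ge1 eB2] := nrm_mulr_bounded (star e).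
(* The adjoint of multiplication by [e] has to be bounded as well. *)
pose B := B1 + B2.
have B1_ge0 : 0 <= B1 by exact: le_trans ler01 B1_ge1.
have B2_ge0 : 0 <= B2 by exact: le_trans ler01 B2_ge1.
have eB x : nrm (x * e) <= B * nrm x.
  by apply: le_trans (eB1 x) _; rewrite ler_wpM2r ?nrm_ge0 // lerDl.
have esB x : nrm (x * star e) <= B * nrm x.
  by apply: le_trans (eB2 x) _; rewrite ler_wpM2r ?nrm_ge0 // lerDr.
have B_ge1 : 1 <= B by apply: le_trans B1_ge1 _; rewrite lerDl.
have B_ge0 : 0 <= B by exact: le_trans ler01 B_ge1.
have Bm1 : 0 <= B - 1 by rewrite subr_ge0.
exists (B * B *+ 14) => [|rho /andP [rho_gt0 rho_le1]].
  by rewrite mulrn_wge0 // mulr_ge0.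
have rho_ge0 := ltW rho_gt0.
have rho2 : rho ^+ 2 <= rho by rewrite expr2 ler_piMr.
have rho4 : rho ^+ 4 <= 1 by exact: exprn_ile1.
have sqr_le (x y : C) : 0 <= x -> 0 <= y -> x ^+ 2 <= y ^+ 2 -> x <= y.
  by move=> x0 y0; rewrite ler_pXn2r.
have [a ea amin] := nearly_closest_exists e (exprn_gt0 4 rho_gt0).
have orth := nearly_closest_orthogonal amin ea.
(* The two errors: of [a] as a projection of [1], and of [a e = e]. *)
pose eta := a - 1; pose u := eta * e.
have eta_le : nrm eta <= 2.
  apply: le_trans (amin 0 (mulr0 _)) _.
  have -> : nrm (0 - 1) = 1 by rewrite sub0r nrmN /nrm dot1r /tr gr_1E mcoeffUU.
  by rewrite -[2]/(1 + 1) lerD2l.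
have uE : u = a * e - e by rewrite /u mulrBl mul1r.
have eu : e * u = u by rewrite uE mulrBr mulrA ea ee.
have u_le : nrm u <= B * rho ^+ 2 *+ 2.
  apply: sqr_le; rewrite ?nrm_ge0 ?mulrn_wge0 ?mulr_ge0 ?exprn_ge0 //.
  have -> : nrm u = `|dot (u * star e) eta|.
    by rewrite dotMr starK -/u ger0_norm ?nrm_ge0.
  have uB : nrm (u * star e) <= B * (B * 2).
    apply: le_trans (esB u) _; rewrite ler_wpM2l //.
    by apply: le_trans (eB eta) _; rewrite ler_wpM2l.
  apply: le_trans (orth _ _ _ uB _) _; first by rewrite mulrA eu.
    by rewrite !mulr_gt0 // (lt_le_trans ltr01).
  rewrite -subr_ge0; have -> : (B * rho ^+ 2 *+ 2) ^+ 2 - rho ^+ 4 * (B * (B * 2)) =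
     (B * B * rho ^+ 4) *+ 2 by ring.
  by rewrite mulrn_wge0 ?mulr_ge0 ?exprn_ge0.
have tra : tr u = tr a by rewrite uE trD trN te subr0 trC ea.
have tra_le : `|tr a| <= B * rho *+ 2.
  apply: sqr_le; rewrite ?normr_ge0 ?mulrn_wge0 ?mulr_ge0 //.
  apply: le_trans (_ : nrm u <= _); first by rewrite -tra nrm_coef.
  apply: le_trans u_le _; rewrite -subr_ge0.
  have -> : (B * rho *+ 2) ^+ 2 - B * rho ^+ 2 *+ 2 =
    (B * rho ^+ 2) * ((B - 1) + (B - 1) + B + B) by ring.
  rewrite mulr_ge0 ?mulr_ge0 ?exprn_ge0 //.
  exact: addr_ge0 (addr_ge0 (addr_ge0 Bm1 Bm1) B_ge0) B_ge0.
have a_le6 : nrm a <= 6.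
  have -> : a = eta + 1 by rewrite subrK.
  apply: le_trans (nrmD_le _ _) _.
  have -> : nrm 1 = 1 by rewrite /nrm dot1r /tr gr_1E mcoeffUU.
  rewrite (_ : 6 = (2 + 1) *+ 2); last by ring.
  by rewrite lerMn2r lerD2r.
have ao_le : `|dot a eta| <= 3 * rho.
  apply: sqr_le; rewrite ?normr_ge0 ?mulr_ge0 //.
  apply: le_trans (orth _ _ ea a_le6 _) _; first by rewrite ltr0n.
  have r42 : rho ^+ 4 <= rho ^+ 2.
    rewrite -[rho ^+ 4]/(rho ^+ (2 + 2)) exprD ler_piMr ?exprn_ge0 //.
    exact: exprn_ile1.
  apply: le_trans (_ : rho ^+ 2 * 6 <= _); first by rewrite ler_wpM2r // ler0n.
  rewrite -subr_ge0.
  have -> : (3 * rho) ^+ 2 - rho ^+ 2 * 6 = rho ^+ 2 *+ 3 by ring.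
  by rewrite mulrn_wge0 ?exprn_ge0.
have a_le : nrm a <= B * rho *+ 5.
  have -> : nrm a = `|dot a eta + tr a|.
    rewrite -dot1r -dotDr /eta subrK ger0_norm //; exact: nrm_ge0.
  apply: le_trans (ler_normD _ _) _; apply: le_trans (lerD ao_le tra_le) _.
  rewrite -subr_ge0; have -> : B * rho *+ 5 - (3 * rho + B * rho *+ 2) =
    (B - 1) * rho *+ 3 by ring.
  by rewrite mulrn_wge0 ?mulr_ge0 ?subr_ge0.
have -> : e = a * e + - u by rewrite uE opprB addrC subrK.
apply: le_trans (nrmD_le _ _) _; rewrite nrmN.
have ae_le : nrm (a * e) <= B * (B * rho *+ 5).
  by apply: le_trans (eB a) _; rewrite ler_wpM2l.
apply: le_trans (_ : (B * (B * rho *+ 5) + B * rho ^+ 2 *+ 2) *+ 2 <= _).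
  by rewrite lerMn2r lerD.
rewrite -subr_ge0.
have -> : B * B *+ 14 * rho - (B * (B * rho *+ 5) + B * rho ^+ 2 *+ 2) *+ 2 =
  (B * ((B - 1) * rho + (rho - rho ^+ 2))) *+ 4 by ring.
by rewrite mulrn_wge0 // mulr_ge0 // addr_ge0 ?mulr_ge0 ?subr_ge0.
Qed.

Theorem idempotent_trace0 e : e * e = e -> tr e = 0 -> e = 0.
Proof.
move=> ee /(idempotent_nrm_small ee) [K K0 eK]; apply: nrm_eq0.
apply/eqP; apply: contraT => n0.
have {n0} ne : 0 < nrm e by rewrite lt_def n0 nrm_ge0.
move: (nrm e) ne eK => N N0 NK.
have := archi_boundP (divr_ge0 K0 (ltW N0)); set n := Num.bound _ => Kn.
have : N <= K * n.+1%:R^-1.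
  by apply: NK; rewrite invr_gt0 ltr0Sn invf_le1 ?ltr0Sn // ler1n.
rewrite ler_pdivlMr ?ltr0Sn // => Nn.
have : N * n.+1%:R < N * n.+1%:R.
  apply: le_lt_trans Nn _; rewrite mulrC -ltr_pdivrMr //.
  by apply: lt_trans Kn _; rewrite ltr_nat.
by rewrite ltxx.
Qed.

End Kaplansky.

(** * Idempotents over fields of characteristic zero *)

Section FieldOfPzRing.
Variables (R : pzRingType) (inv : R -> R).
Hypothesis one_neq0 : 1 != 0 :> R.
Hypothesis mulC : forall x y : R, x * y = y * x.
Hypothesis invP : forall x : R, x != 0 -> inv x * x = 1.
Hypothesis inv0 : inv 0 = 0.

Let nz := GRing.PzSemiRing_isNonZero.Build R one_neq0.
Let cm := GRing.PzRing_hasCommutativeMul.Build R mulC.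
Let CR : comNzRingType := HB.pack (GRing.PzRing.sort R) nz cm.
Let fd := GRing.ComNzRing_isField.Build CR invP inv0.

Definition field_of : fieldType := HB.pack (GRing.PzRing.sort R) nz cm fd.

End FieldOfPzRing.

(** An equality of rings, not merely an isomorphism, so that a statement about a
   field given by its axioms can be rewritten into one about a [fieldType]. *)
Lemma is_fieldE (R : pzRingType) :
  is_field R -> exists K : fieldType, R = K :> pzRingType.
Proof.
move=> [[R1 RV] RC].
have [inv [invP inv0]] : exists inv : R -> R,
    (forall x, x != 0 -> inv x * x = 1) /\ inv 0 = 0.
  have /choice [inv invP] : forall x : R, exists y,
      (x != 0 -> y * x = 1) /\ (x = 0 -> y = 0).
    move=> x; have [->|x0] := eqVneq x 0; first by exists 0.
    have [y [_ yx]] := RV x x0.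
    by exists y; split=> // /eqP; rewrite (negPf x0).
  by exists inv; split=> [x|]; [exact: (invP x).1|exact: (invP 0).2].
exists (field_of R1 RC invP inv0).
by case: R R1 RC inv invP inv0 {RV}.
Qed.

(** A nonzero coefficient of [p] is kept while all coefficients are specialized to
   algebraic numbers. The lift [q] of [p] is idempotent of trace zero only up to
   relations between the coefficients of [p], which the specialization respects. *)
Lemma char0_idempotent_trace0 (K : fieldType) (G : groupType)
    (p : grpring K G) :
  char_zero K -> p * p = p -> p@_1%g = 0 -> p = 0.
Proof.
move=> K0 pp tp; apply/malgP => g; rewrite mcoeff0; apply/eqP.
apply: contraT => pg.
have [||P [iota [spec img]]] :=
  @specializable_seq K algC [seq p@_h | h <- msupp p].
- exact: K0.
- by move=> n n0; rewrite pnatr_eq0 -lt0n.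
have [I IE] := gr_map_exists G iota.
have [q qp] : exists q, I q = p.
  have sp h : h \in (msupp p : seq G) -> exists a, iota a = p@_h.
    by move=> hp; apply/img/map_f.
  rewrite (grpring_sum p); elim: (msupp p : seq G) sp => [|h s IHs] sp.
    by exists 0; rewrite big_nil rmorph0.
  have [|q qE] := IHs; first by move=> h' h's; apply: sp; rewrite inE h's orbT.
  have [a ah] := sp h (mem_head _ _).
  exists (<< a *g h >> + q); rewrite rmorphD qE big_cons; congr (_ + _).
  by apply/malgP => k; rewrite IE !mcoeffU rmorphMn ah.
have [phi [phig kphi]] : exists phi : {rmorphism P -> algC},
    phi q@_g != 0 /\ forall a, iota a = 0 -> phi a = 0.
  by apply: spec; rewrite -IE qp.
have [F FE] := gr_map_exists G phi.
have kF x : I x = 0 -> F x = 0.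
  by move=> Ix; apply/malgP => k; rewrite FE mcoeff0 kphi // -IE Ix mcoeff0.
have Fq : F q = 0.
  apply: idempotent_trace0.
    apply/eqP; rewrite -subr_eq0 -rmorphM -rmorphB kF //.
    by rewrite rmorphB rmorphM qp pp subrr.
  by rewrite /tr FE kphi // -IE qp.
by move: phig; rewrite -FE Fq mcoeff0 eqxx.
Qed.

Lemma field_idempotent_trace0 (R : pzRingType) (G : groupType)
    (p : grpring R G) :
  is_field R -> char_zero R -> p * p = p -> p@_1%g = 0 -> p = 0.
Proof.
by move=> /is_fieldE [K RK]; subst R; exact: char0_idempotent_trace0.
Qed.

Theorem theorem0p12 (G : groupType) (R : pzRingType) :
  trivial_idempotents R ->
  bijective (K0Q_map (gr_incl R G)) ->
  [\/ stably_finite (grpring R G),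
      is_field R /\ char_zero R
    | is_skew_field R /\ sofic G] ->
  trivial_idempotents (grpring R G).
Proof.
move=> trivR bij cases.
have [eps epsU] := augmentation_exists R G.
have inclK : cancel (gr_incl R G) eps by move=> r; exact: epsU.
have kills p : p * p = p -> eps p = 0 -> p = 0.
  move=> pp ep; have [k kp] := idempotent_class_torsion pp inclK bij ep.
  case: cases => [sf|[fR R0]|[skR sG]].
  - exact: idempotent_eq0_stably_finite sf kp.
  - have := torsion_trace0 fR.2 kp; rewrite -mulr_natr => tp.
    have {tp}: p@_1%g = 0 by apply: (skew_mulf_eq0 fR.1 (R0 k.+1 isT) tp).
    exact: field_idempotent_trace0 fR R0 pp.
  - exact: idempotent_eq0_stably_finite (sofic_stably_finite skR sG) kp.
move=> p pp; have : eps p * eps p = eps p by rewrite -rmorphM pp.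
case/trivR => [/(kills p pp) ->|ep]; [by left|right].
have qq : (1 - p) * (1 - p) = 1 - p.
  by rewrite mulrBl mul1r mulrBr mulr1 pp subrr subr0.
by apply/esym/eqP; rewrite -subr_eq0 (kills _ qq) // rmorphB rmorph1 ep subrr.
Qed.
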